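(* Let $\mathcal{RS}_{\rm v}:\Omega^2\to\mathbf{BV}(\mathbb{R};\Omega)$ be the coupling Riemann solver of the two-way electronic pressure valve defined in the context. Then: (I) The coherence domain of $\mathcal{RS}_{\rm v}$ is $\mathsf{CH}=\mathsf{A}\cup\mathsf{O}_{\mathsf{O}}$, where $\mathsf{O}_{\mathsf{O}}\doteq\{(u_\ell,u_r)\in\mathsf{O}\colon (u_{\rm p}^-,u_{\rm p}^+)\in\mathsf{O}\}$. (II) The consistence domain of $\mathcal{RS}_{\rm v}$ is $\mathsf{CN}=\mathsf{CN}_1\cup\mathsf{CN}_2=\mathsf{CN}_{\mathsf{O}}\cup\mathsf{CN}_{\mathsf{A}}$, where $$\mathsf{CN}_1\doteq\{(u_\ell,u_r)\in\mathsf{A}_{\mathsf I}\colon (u_\ell,u_{\rm v}(\xi_o^-)),\,(u_{\rm v}(\xi_o^+),u_r)\in\mathsf{A}_{\mathsf I}^{c}\text{ for any }\xi_o^-<0\le\xi_o^+\},$$ $$\mathsf{CN}_2\doteq\{(u_\ell,u_r)\in\mathsf{A}_{\mathsf I}^{c}\colon (u_\ell,u_{\rm v}(\xi_o)),\,(u_{\rm v}(\xi_o),u_r)\in\mathsf{A}_{\mathsf I}^{c}\text{ for any }\xi_o\in\mathbb{R}\},$$ $$\mathsf{CN}_{\mathsf{O}}\doteq\{(u_\ell,u_r)\in\mathsf{O}\colon (u_\ell,u_\ell),(u_r,u_r),(u_\ell,\tilde u),(\tilde u,u_r)\in\mathsf{A}_{\mathsf I}^{c}\text{ and }q_{\rm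 p}\neq0\text{ along any rarefaction}\},$$ $$\mathsf{CN}_{\mathsf{A}}\doteq\{(u_\ell,u_r)\in\mathsf{A}\colon q_\ell\ge0\ge q_r,\ (u_\ell,u_\ell)\in\mathsf{A}_{\mathsf I}^{c},\ (u_r,u_r)\in\mathsf{A}_{\mathsf I}^{c}\}.$$ (III) The $\mathbf{L}^1_{loc}$-continuity domain of $\mathcal{RS}_{\rm v}$ is $\mathsf{L}=\{(u_\ell,u_r)\in\Omega^2\colon |\check p_r-\hat p_\ell|\neq M\}$. (IV) If $u_0\in\Omega$ is such that $q_0=0$, then $\mathcal{I}_{u_0}\doteq\{u\in\Omega\colon z(u)\ge z(u_0),\ w(u)\le w(u_0)\}$ is an invariant domain of $\mathcal{RS}_{\rm v}$.
   Context: Fix constants $a>0$, $M>0$. Let $\Omega=\{u=(\rho,q)\in\mathbb{R}^2\colon\rho>0\}$, $v=q/\rho$, $p(\rho)=a^2\rho$, $\lambda_1(u)=v-a$, $\lambda_2(u)=v+a$, $w(u)=\frac{q}{a\rho}+\log\rho$, $z(u)=\frac{q}{a\rho}-\log\rho$. Decorations and subscripts carry over to components (e.g. $u_\ell=(\rho_\ell,q_\ell)$, $\hat p_\ell=p(\hat\rho_\ell)$). $\mathbf{BV}(\mathbb{R};\Omega)$ is the space of $\Omega$-valued functions of bounded variation, taken right continuous. Lax curves. For $u_*\in\Omega$, $\rho>0$: $\mathcal{R}_1(\rho,u_* )=\rho[v_*-a\log(\rho/\rho_* )]$, $\mathcal{R}_2(\rho,u_* )=\rho[v_*+a\log(\rho/\rho_*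 )]$, $\mathcal{S}_1(\rho,u_* )=\rho[v_*-a(\sqrt{\rho/\rho_*}-\sqrt{\rho_*/\rho})]$, $\mathcal{S}_2(\rho,u_* )=\rho[v_*+a(\sqrt{\rho/\rho_*}-\sqrt{\rho_*/\rho})]$. The curve $\mathcal{FL}_1^{u_*}$ is the graph $q=\mathcal{R}_1(\rho,u_* )$ for $\rho\le\rho_*$, $q=\mathcal{S}_1(\rho,u_* )$ for $\rho>\rho_*$; $\mathcal{FL}_2^{u_*}$ is $q=\mathcal{S}_2(\rho,u_* )$ for $\rho<\rho_*$, $q=\mathcal{R}_2(\rho,u_* )$ for $\rho\ge\rho_*$; $\mathcal{BL}_2^{u_*}$ is $q=\mathcal{R}_2(\rho,u_* )$ for $\rho\le\rho_*$, $q=\mathcal{S}_2(\rho,u_* )$ for $\rho>\rho_*$. Let $\tilde u=\tilde u(u_\ell,u_r)$ be the unique element of $\mathcal{FL}_1^{u_\ell}\cap\mathcal{BL}_2^{u_r}$. Lax Riemann solver $\mathcal{RS}_{\rm p}:\Omega^2\to\mathbf{BV}(\mathbb{R};\Omega)$: $\mathcal{RS}_{\rm p}[u_\ell,u_r]$ is the juxtaposition of a 1-wave from $u_\ell$ to $\tilde u$ (for $\xi<\tilde q/\tilde\rho$) and a 2-wave from $\tilde u$ to $u_r$ (for $\xi\ge\tilde q/\tilde\rho$). An $i$-wave from $u_-$ to $u_+\in\mathcal{FL}_i^{u_-}$ is constant if $u_-=u_+$; it is a shock if $\rho_+>\rho_-$ ($i=1$), resp. $\rho_+<\rho_-$ ($i=2$),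 equal to $u_-$ for $\xi<\sigma$ and $u_+$ for $\xi\ge\sigma$, $\sigma=(q_+-q_-)/(\rho_+-\rho_-)$; otherwise it is a rarefaction, equal to $u_-$ for $\xi<\lambda_i(u_-)$, to $u_+$ for $\xi>\lambda_i(u_+)$, and for $\lambda_i(u_-)\le\xi\le\lambda_i(u_+)$ to the state on the graph of $\mathcal{R}_i(\cdot,u_-)$ with $\lambda_i=\xi$. Write $u_{\rm p}=(\rho_{\rm p},q_{\rm p})=\mathcal{RS}_{\rm p}[u_\ell,u_r]$ and $u_{\rm p}^\pm=u_{\rm p}(0^\pm)$. ''$q_{\rm p}\ne0$ along any rarefaction'' means: for each (nontrivial) rarefaction of $u_{\rm p}$, from $u_-$ to $u_+$ of family $i$, $q_{\rm p}(\xi)\neq0$ for all $\xi\in[\lambda_i(u_-),\lambda_i(u_+)]$. The valve. For $u\in\Omega$ let $\hat u(u)$, resp. $\check u(u)$, be the intersection of $\mathcal{FL}_1^{u}$, resp. $\mathcal{BL}_2^{u}$, with $\{q=0\}$; $\hat u_\ell=\hat u(u_\ell)$, $\check u_r=\check u(u_r)$. Set $\mathsf{A}=\{(u_\ell,u_r)\in\Omega^2\colon|\check p_r-\hat p_\ell|\le M\}$ (valve active, i.e. closed), $\mathsf{O}=\Omega^2\setminus\mathsf{A}$ (valve open). Define $u_{\rm v}=\mathcal{RS}_{\rm v}[u_\ell,u_r]$ by $u_{\rm v}=\mathcal{RS}_{\rm p}[u_\ell,u_r]$ if $(u_\ell,u_r)\in\mathsf{O}$, while if $(u_\ell,u_r)\in\mathsf{A}$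 then $u_{\rm v}(\xi)=\mathcal{RS}_{\rm p}[u_\ell,\hat u_\ell](\xi)$ for $\xi<0$ and $u_{\rm v}(\xi)=\mathcal{RS}_{\rm p}[\check u_r,u_r](\xi)$ for $\xi\ge0$. Set $\mathsf{A}_{\mathsf N}=\{(u_\ell,u_r)\in\mathsf{A}\colon u_{\rm v}\equiv u_{\rm p}\}=\{(u_\ell,u_r)\in\Omega^2\colon\tilde q=0\}$, $\mathsf{A}_{\mathsf I}=\mathsf{A}\setminus\mathsf{A}_{\mathsf N}$, $\mathsf{A}_{\mathsf I}^{c}=\Omega^2\setminus\mathsf{A}_{\mathsf I}=\mathsf{O}\cup\mathsf{A}_{\mathsf N}$. Properties. Coherent at $(u_\ell,u_r)$: $\mathcal{RS}_{\rm v}[u_{\rm v}(0^-),u_{\rm v}(0^+)](\xi)$ equals $u_{\rm v}(0^-)$ for $\xi<0$ and $u_{\rm v}(0^+)$ for $\xi\ge0$. Consistent at $(u_\ell,u_r)$: for every $\xi_o\in\mathbb{R}$, (cn.1) $\mathcal{RS}_{\rm v}[u_\ell,u_{\rm v}(\xi_o)](\xi)$ equals $u_{\rm v}(\xi)$ for $\xi<\xi_o$ and $u_{\rm v}(\xi_o)$ for $\xi\ge\xi_o$, and $\mathcal{RS}_{\rm v}[u_{\rm v}(\xi_o),u_r](\xi)$ equals $u_{\rm v}(\xi_o)$ for $\xi<\xi_o$ and $u_{\rm v}(\xi)$ for $\xi\ge\xi_o$; (cn.2) $u_{\rm v}(\xi)$ equals $\mathcal{RS}_{\rm v}[u_\ell,u_{\rm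 v}(\xi_o)](\xi)$ for $\xi<\xi_o$ and $\mathcal{RS}_{\rm v}[u_{\rm v}(\xi_o),u_r](\xi)$ for $\xi\ge\xi_o$. $\mathbf{L}^1_{loc}$-continuous at $(u_\ell,u_r)$: for all $\xi_1,\xi_2\in\mathbb{R}$, $\int_{\xi_1}^{\xi_2}\|\mathcal{RS}_{\rm v}[u_\ell^\varepsilon,u_r^\varepsilon](\xi)-\mathcal{RS}_{\rm v}[u_\ell,u_r](\xi)\|\,d\xi\to0$ as $(u_\ell^\varepsilon,u_r^\varepsilon)\to(u_\ell,u_r)$ in $\Omega^2$. The coherence, consistence and $\mathbf{L}^1_{loc}$-continuity domains are the sets of all pairs in $\Omega^2$ where the respective property holds. A set $\mathcal{I}\subseteq\Omega$ is an invariant domain of $\mathcal{RS}_{\rm v}$ if $\mathcal{RS}_{\rm v}[u_\ell,u_r](\mathbb{R})\subseteq\mathcal{I}$ for all $u_\ell,u_r\in\mathcal{I}$. *)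

(* Defs.v *)
From HB Require Import structures.
From mathcomp Require Import all_boot all_order all_algebra.
From mathcomp Require Import all_classical all_reals all_analysis.

Set Implicit Arguments.
Unset Strict Implicit.
Unset Printing Implicit Defensive.

Import Order.TTheory GRing.Theory Num.Theory.
Import numFieldNormedType.Exports.

Local Open Scope classical_set_scope.
Local Open Scope ring_scope.

(* A state u = (rho, q) is a pair: u.1 is the density, u.2 the momentum.
   All the functions below are total on R * R; only their values at states
   of Omega are meaningful. *)
Notation state R := (R * R)%type.

Definition Omega (R : realType) : set (state R) := [set u | 0 < u.1].

Definition Omega2 (R : realType) : set (state R * state R) :=
  @Omega R `*` @Omega R.

Definition velocity (R : realType) (u : state R) : R := u.2 / u.1.

Definition pressure (R : realType) (a rho : R) : R := a ^+ 2 * rho.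

Definition lambda1 (R : realType) (a : R) (u : state R) : R := velocity u - a.

Definition lambda2 (R : realType) (a : R) (u : state R) : R := velocity u + a.

Definition winv (R : realType) (a : R) (u : state R) : R :=
  u.2 / (a * u.1) + ln u.1.

Definition zinv (R : realType) (a : R) (u : state R) : R :=
  u.2 / (a * u.1) - ln u.1.

Definition R1 (R : realType) (a rho : R) (us : state R) : R :=
  rho * (velocity us - a * ln (rho / us.1)).

Definition R2 (R : realType) (a rho : R) (us : state R) : R :=
  rho * (velocity us + a * ln (rho / us.1)).

Definition S1 (R : realType) (a rho : R) (us : state R) : R :=
  rho * (velocity us - a * (Num.sqrt (rho / us.1) - Num.sqrt (us.1 / rho))).

Definition S2 (R : realType) (a rho : R) (us : state R) : R :=
  rho * (velocity us + a * (Num.sqrt (rho / us.1) - Num.sqrt (us.1 / rho))).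

Definition FL1 (R : realType) (a : R) (us : state R) : set (state R) :=
  [set u | 0 < u.1 /\
           u.2 = if u.1 <= us.1 then R1 a u.1 us else S1 a u.1 us].

Definition BL2 (R : realType) (a : R) (us : state R) : set (state R) :=
  [set u | 0 < u.1 /\
           u.2 = if u.1 <= us.1 then R2 a u.1 us else S2 a u.1 us].

(* [xget d X] is an element of X when X is nonempty, and d otherwise. On Omega
   and for a > 0, the sets to which it is applied below are singletons (in
   raref_state, for every xi), so that the default values are irrelevant. *)
Definition utilde (R : realType) (a : R) (ul ur : state R) : state R :=
  xget ul (FL1 a ul `&` BL2 a ur).

Definition uhat (R : realType) (a : R) (u : state R) : state R :=
  xget u (FL1 a u `&` [set v | v.2 = 0]).

Definition ucheck (R : realType) (a : R) (u : state R) : state R :=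
  xget u (BL2 a u `&` [set v | v.2 = 0]).

(* State with characteristic speed xi on the graph of the rarefaction curve
   [Rc] issued from um; (lam, Rc) is (lambda_i, R_i). *)
Definition raref_state (R : realType) (lam : state R -> R)
    (Rc : R -> state R -> R) (um : state R) (xi : R) : state R :=
  xget um [set u | [/\ 0 < u.1, u.2 = Rc u.1 um & lam u = xi]].

Definition wave (R : realType) (lam : state R -> R) (Rc : R -> state R -> R)
    (is_shock : bool) (um up : state R) (xi : R) : state R :=
  if um == up then um
  else if is_shock then
    if xi < (up.2 - um.2) / (up.1 - um.1) then um else up
  else if xi < lam um then um
  else if lam up < xi then up
  else raref_state lam Rc um xi.

Definition wave1 (R : realType) (a : R) (um up : state R) : R -> state R :=
  wave (lambda1 a) (R1 a) (um.1 < up.1) um up.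

Definition wave2 (R : realType) (a : R) (um up : state R) : R -> state R :=
  wave (lambda2 a) (R2 a) (up.1 < um.1) um up.

Definition RSp (R : realType) (a : R) (ul ur : state R) (xi : R) : state R :=
  let ut := utilde a ul ur in
  if xi < velocity ut then wave1 a ul ut xi else wave2 a ut ur xi.

Definition trace_left (R : realType) (f : R -> state R) : state R :=
  (lim ((f xi).1 @[xi --> 0^'-]), lim ((f xi).2 @[xi --> 0^'-])).

Definition trace_right (R : realType) (f : R -> state R) : state R :=
  (lim ((f xi).1 @[xi --> 0^'+]), lim ((f xi).2 @[xi --> 0^'+])).

(* The 1-wave of RSp[ul, ur], from ul to utilde, is a nontrivial rarefaction
   iff the density decreases along it; the 2-wave, from utilde to ur, iff the
   density increases along it. *)
Definition q_neq0_along_rarefactions (R : realType) (a : R)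
    (ul ur : state R) : Prop :=
  let ut := utilde a ul ur in
  (ut.1 < ul.1 -> forall xi, lambda1 a ul <= xi <= lambda1 a ut ->
     (RSp a ul ur xi).2 != 0) /\
  (ut.1 < ur.1 -> forall xi, lambda2 a ut <= xi <= lambda2 a ur ->
     (RSp a ul ur xi).2 != 0).

Definition pressure_jump (R : realType) (a : R) (ul ur : state R) : R :=
  `|pressure a (ucheck a ur).1 - pressure a (uhat a ul).1|.

Definition valveA (R : realType) (a M : R) : set (state R * state R) :=
  [set p | @Omega2 R p /\ pressure_jump a p.1 p.2 <= M].

Definition valveO (R : realType) (a M : R) : set (state R * state R) :=
  @Omega2 R `\` valveA a M.

Definition RSv (R : realType) (a M : R) (ul ur : state R) (xi : R) : state R :=
  if `[< valveA a M (ul, ur) >] then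
    if xi < 0 then RSp a ul (uhat a ul) xi else RSp a (ucheck a ur) ur xi
  else RSp a ul ur xi.

Definition valveAN (R : realType) (a M : R) : set (state R * state R) :=
  [set p | valveA a M p /\ forall xi, RSv a M p.1 p.2 xi = RSp a p.1 p.2 xi].

Definition valveAI (R : realType) (a M : R) : set (state R * state R) :=
  valveA a M `\` valveAN a M.

Definition valveAIc (R : realType) (a M : R) : set (state R * state R) :=
  @Omega2 R `\` valveAI a M.

Definition coherent (R : realType) (a M : R) (ul ur : state R) : Prop :=
  let um := trace_left (RSv a M ul ur) in
  let up := trace_right (RSv a M ul ur) in
  forall xi, RSv a M um up xi = if xi < 0 then um else up.

Definition consistent (R : realType) (a M : R) (ul ur : state R) : Prop :=
  let uv := RSv a M ul ur in
  forall xio,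
    [/\ (forall xi, RSv a M ul (uv xio) xi =
           if xi < xio then uv xi else uv xio),
        (forall xi, RSv a M (uv xio) ur xi =
           if xi < xio then uv xio else uv xi)
      & (forall xi, uv xi =
           if xi < xio then RSv a M ul (uv xio) xi
           else RSv a M (uv xio) ur xi)].

Definition enorm (R : realType) (u : state R) : R :=
  Num.sqrt (u.1 ^+ 2 + u.2 ^+ 2).

(* For x2 < x1 the interval is empty; this is harmless, since x1 and x2 are
   both universally quantified. *)
Definition L1loc_continuous (R : realType) (a M : R) (ul ur : state R) : Prop :=
  forall x1 x2 : R,
    (fun p : state R * state R =>
       (\int[@lebesgue_measure R]_(xi in `[x1, x2])
          (enorm (RSv a M p.1 p.2 xi - RSv a M ul ur xi))%:E)%E)
      @ within (@Omega2 R) (nbhs (ul, ur)) --> (0%:E : \bar R).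

Definition coherence_domain (R : realType) (a M : R) :
    set (state R * state R) :=
  [set p | @Omega2 R p /\ coherent a M p.1 p.2].

Definition consistence_domain (R : realType) (a M : R) :
    set (state R * state R) :=
  [set p | @Omega2 R p /\ consistent a M p.1 p.2].

Definition L1loc_continuity_domain (R : realType) (a M : R) :
    set (state R * state R) :=
  [set p | @Omega2 R p /\ L1loc_continuous a M p.1 p.2].

Definition invariant_domain (R : realType) (a M : R) (I : set (state R)) :
    Prop :=
  I `<=` @Omega R /\
  forall ul ur, I ul -> I ur -> range (RSv a M ul ur) `<=` I.

Definition valveOO (R : realType) (a M : R) : set (state R * state R) :=
  [set p | valveO a M p /\
     valveO a M (trace_left (RSp a p.1 p.2), trace_right (RSp a p.1 p.2))].

Definition CH (R : realType) (a M : R) : set (state R * state R) :=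
  valveA a M `|` valveOO a M.

Definition CN1 (R : realType) (a M : R) : set (state R * state R) :=
  [set p | valveAI a M p /\
     forall xim xip : R, xim < 0 <= xip ->
       valveAIc a M (p.1, RSv a M p.1 p.2 xim) /\
       valveAIc a M (RSv a M p.1 p.2 xip, p.2)].

Definition CN2 (R : realType) (a M : R) : set (state R * state R) :=
  [set p | valveAIc a M p /\
     forall xio : R,
       valveAIc a M (p.1, RSv a M p.1 p.2 xio) /\
       valveAIc a M (RSv a M p.1 p.2 xio, p.2)].

Definition CNO (R : realType) (a M : R) : set (state R * state R) :=
  [set p | valveO a M p /\
     [/\ valveAIc a M (p.1, p.1), valveAIc a M (p.2, p.2),
         valveAIc a M (p.1, utilde a p.1 p.2),
         valveAIc a M (utilde a p.1 p.2, p.2)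
       & q_neq0_along_rarefactions a p.1 p.2]].

Definition CNA (R : realType) (a M : R) : set (state R * state R) :=
  [set p | valveA a M p /\
     [/\ p.1.2 >= 0, 0 >= p.2.2,
         valveAIc a M (p.1, p.1) & valveAIc a M (p.2, p.2)]].

Definition Ldom (R : realType) (a M : R) : set (state R * state R) :=
  [set p | @Omega2 R p /\ pressure_jump a p.1 p.2 != M].

Definition Idom (R : realType) (a : R) (u0 : state R) : set (state R) :=
  [set u | [/\ @Omega R u, zinv a u >= zinv a u0 & winv a u <= winv a u0]].

(* Main.v *)
Require Import Defs.
From mathcomp Require Import all_boot all_order all_algebra.
From mathcomp Require Import all_classical all_reals all_analysis.
From mathcomp Require Import measurable_realfun ring lra.

(* In the coordinates c = a log rho and v = q / rho every curve of the problem
   is a graph over c with the same profile: FL1 is v = v0 - lax (c - c0) and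
   BL2 is v = v0 + lax (c - c0), where lax is the identity on the negative
   reals, strictly increasing, and lax - id is nondecreasing. Rarefactions are
   segments on which v + c (family 1) or v - c (family 2) is constant, and the
   states at rest uhat and ucheck have c-coordinates hatc = c + laxV v and
   checkc = c + laxV (- v), laxV being the inverse of lax. The middle velocity
   has the sign of hatc ul - checkc ur, so that the valve sets depend on
   (ul, ur) only through these two numbers.

   (I) If RSp has velocity zero at xi = 0, its value there is the middle state.
   (II) RSp is consistent everywhere, so that consistence of RSv is the
   coincidence of RSv and RSp on all truncated data. Along a rarefaction hatc
   and checkc are monotone, so that the end states decide, unless the velocity
   vanishes, in which case nearby states keep the valve closed.
   (III) The middle state is Lipschitz in the data, RSp converges pointwise off
   three values of xi, and dominated convergence applies. When the pressure
   jump is M, data with a larger jump accumulate at (ul, ur), and the limit RSp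
   differs from RSv to the right of 0.
   (IV) This follows from lax s >= s and laxV y <= y. *)

Set Implicit Arguments.
Unset Strict Implicit.
Unset Printing Implicit Defensive.

Import Order.TTheory GRing.Theory Num.Theory.
Import numFieldNormedType.Exports.

Local Open Scope classical_set_scope.
Local Open Scope ring_scope.

(** One inequality carries the analysis: [lax] grows at least as fast as its argument. It yields the
    existence, the uniqueness and the stability of the middle state. Since [RSp] is consistent,
    (cn.1) forces [RSv] to agree with [RSp] on the truncated pairs lying on one side of a closed
    valve. The pairs that still straddle it cause no difficulty, because [hatc] is conserved along
    the 1-wave towards [uhat] and [checkc] along the 2-wave from [ucheck]. A fan through velocity 0
    produces such close distinct values; a fan that avoids 0 moves the two coordinates in a
    controlled direction. Second-family fans are reduced to first-family ones by changing the sign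
    of the velocity. The threshold jump belongs to [valveA], so discontinuity there is seen only
    along data that open the valve. *)

Lemma expanding_surj (R : realType) (f : R -> R) : continuous f ->
  (forall s t, s <= t -> t - s <= f t - f s) -> forall y, exists x, f x = y.
Proof.
move=> cf ef y; set b := `|y - f 0|.
have b0 : 0 <= b by exact: normr_ge0.
have := ef 0 b b0; have : - b <= 0 by rewrite oppr_le0.
move/ef => f1 f2.
have /andP[y1 y2] : - b <= y - f 0 <= b by rewrite -ler_norml.
have [] := @IVT R f (- b) b y.
- lra.
- exact: continuous_subspaceT.
- by rewrite ge_min le_max; apply/andP; split; apply/orP; [left|right]; lra.
- by move=> x _ <-; exists x.
Qed.

(** The function [g] is 2 sinh t - 2 t; adding exp x >= 1 + x at t and at - t shows that its
    derivative is nonnegative. *)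
Lemma expR_subN_expand (R : realType) (x y : R) : x <= y ->
  2 * (y - x) <= (expR y - expR (- y)) - (expR x - expR (- x)).
Proof.
move=> xy; pose g (t : R) := expR t - expR (- t) - 2 * t.
have dg (t : R) : is_derive t 1 g (expR t + expR (- t) - 2).
  apply: is_derive_eq.
  by rewrite /GRing.scale /=; ring.
suff : g x <= g y by rewrite /g; lra.
have cg : continuous g.
  by move=> t; apply: differentiable_continuous; exact/derivable1_diffP.
apply: (@ger0_derive1_ndecr R g x y) => // [t _|].
- by rewrite derive1E derive_val; have := expR_ge1Dx t; have := expR_ge1Dx (- t); lra.
- exact: continuous_subspaceT.
Qed.

(** * The Lax profile and its inverse *)

Section Lax.
Variables (R : realType) (a : R).
Hypothesis a_gt0 : 0 < a.

(* Velocity gap along a Lax curve, as a function of the increment of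
   [a * ln rho]: the identity on rarefactions ([s <= 0]), and
   [2 a sinh (s / (2 a))] on shocks. *)
Definition lax (s : R) : R := Num.min s 0 +
  a * (expR (Num.max s 0 / (2 * a)) - expR (- (Num.max s 0 / (2 * a)))).

Lemma lax_npos s : s <= 0 -> lax s = s.
Proof.
by move=> s0; rewrite /lax min_l// max_r// mul0r oppr0 subrr mulr0 addr0.
Qed.

Lemma lax0 : lax 0 = 0. Proof. exact: lax_npos. Qed.

Lemma lax_pos s : 0 <= s ->
  lax s = a * (expR (s / (2 * a)) - expR (- (s / (2 * a)))).
Proof. by move=> s0; rewrite /lax min_r// max_l// add0r. Qed.

Lemma lax_continuous : continuous lax.
Proof.
move=> s.
have cmax : {for s, continuous (fun t : R => Num.max t 0 / (2 * a))}.
  apply: cvgM; last exact: cvg_cst.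
  by apply: (@continuous_max R R id (cst 0) s); [exact: cvg_id|exact: cvg_cst].
apply: cvgD.
  by apply: (@continuous_min R R id (cst 0) s); [exact: cvg_id|exact: cvg_cst].
apply: cvgM; first exact: cvg_cst.
apply: cvgB.
  by apply: continuous_cvg => //; exact: continuous_expR.
by apply: continuous_cvg; [exact: continuous_expR|exact: cvgN].
Qed.

(** The rarefaction branch has slope one, and the sinh branch at least one by convexity from slope
    one at 0; arguments of opposite signs are compared through 0. *)
Lemma lax_expand s t : s <= t -> t - s <= lax t - lax s.
Proof.
have pos x y : 0 <= x -> x <= y -> y - x <= lax y - lax x.
  move=> x0 xy; rewrite !lax_pos//; last exact: le_trans xy.
  have /expR_subN_expand : x / (2 * a) <= y / (2 * a).
    by rewrite ler_pM2r// invr_gt0 mulr_gt0.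
  rewrite -(ler_pM2l a_gt0).
  suff -> : a * (2 * (y / (2 * a) - x / (2 * a))) = y - x by lra.
  by field; rewrite gt_eqF.
move=> st; have [s0|s0] := leP 0 s; first exact: pos.
have [t0|t0] := leP 0 t; last by rewrite !lax_npos//; lra.
by have := pos 0 t (lexx _) t0; rewrite lax0 (lax_npos (ltW s0)); lra.
Qed.

Lemma lax_lt : {mono lax : s t / s < t}.
Proof.
move=> s t; have [st|ts] := ltP s t; first by have := lax_expand (ltW st); lra.
by have := lax_expand ts; apply: contraTF; lra.
Qed.

Lemma lax_le : {mono lax : s t / s <= t}.
Proof. by move=> s t; rewrite !leNgt lax_lt. Qed.

Lemma lax_inj : injective lax.
Proof. by move=> s t st; apply: le_anti;
  rewrite -lax_le -[X in _ && X]lax_le st lexx. Qed.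

Lemma lax_ge s : s <= lax s.
Proof.
have [s0|s0] := leP 0 s; last by rewrite lax_npos// ltW.
by have := lax_expand s0; rewrite lax0; lra.
Qed.

Definition laxV (y : R) : R := xget 0 [set s | lax s = y].

Lemma laxVK y : lax (laxV y) = y.
Proof.
by rewrite /laxV; case: xgetP => [s _ //|];
  have [s sy] := expanding_surj lax_continuous lax_expand y => /(_ s).
Qed.

Lemma laxK s : laxV (lax s) = s.
Proof. by apply: lax_inj; rewrite laxVK. Qed.

Lemma laxV_npos y : y <= 0 -> laxV y = y.
Proof. by move=> y0; rewrite -{1}(lax_npos y0) laxK. Qed.

Lemma laxV0 : laxV 0 = 0. Proof. exact: laxV_npos. Qed.

Lemma laxV_le : {mono laxV : y z / y <= z}.
Proof. by move=> y z; rewrite -lax_le !laxVK. Qed.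

Lemma laxV_lt : {mono laxV : y z / y < z}.
Proof. by move=> y z; rewrite -lax_lt !laxVK. Qed.

Lemma laxV_contract y z : y <= z -> laxV z - laxV y <= z - y.
Proof. by rewrite -laxV_le => /lax_expand; rewrite !laxVK. Qed.

Lemma laxV_le_id y : laxV y <= y.
Proof. by rewrite -{2}(laxVK y); exact: lax_ge. Qed.

(* A 1-shock from [u-] to [u+] travels at speed [v- - shock_gap s] and a 2-shock
   at speed [v+ + shock_gap s], [s] being the increase of [a * ln rho]. *)
Definition shock_gap (s : R) : R := a * expR (s / (2 * a)).

Lemma shock_gap_gt0 s : 0 < shock_gap s.
Proof. by rewrite mulr_gt0// expR_gt0. Qed.

(** The sinh is its growing exponential minus a positive term. Consequently a 1-shock is slower than
    its right state and a 2-shock faster than its left state. *)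
Lemma lax_lt_gap s : lax s < shock_gap s.
Proof.
have [s0|s0] := leP 0 s; last first.
  by rewrite lax_npos ?ltW//; apply: lt_trans (shock_gap_gt0 s).
by rewrite lax_pos// ltr_pM2l// gtrBl expR_gt0.
Qed.

Lemma shock_gap_continuous : continuous shock_gap.
Proof.
move=> s; apply: cvgM; first exact: cvg_cst.
apply: continuous_cvg; first exact: continuous_expR.
by apply: cvgM; [exact: cvg_id|exact: cvg_cst].
Qed.

(** * Logarithmic coordinates, Lax curves and the middle state *)

Definition lrho (u : state R) : R := a * ln u.1.

Definition mkst (c v : R) : state R := (expR (c / a), v * expR (c / a)).

Let a_neq0 : a != 0. Proof. by rewrite gt_eqF. Qed.

Lemma Omega_mkst c v : Omega (mkst c v).
Proof. exact: expR_gt0. Qed.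

Lemma lrho_mkst c v : lrho (mkst c v) = c.
Proof. by rewrite /lrho /= expRK mulrC divfK. Qed.

Lemma velocity_mkst c v : velocity (mkst c v) = v.
Proof. by rewrite /velocity /= mulfK// gt_eqF// expR_gt0. Qed.

Lemma mkst_lrho (u : state R) : Omega u -> mkst (lrho u) (velocity u) = u.
Proof.
case: u => r q /= r0; rewrite /mkst /lrho /velocity /= mulrC mulKf//.
by rewrite lnK// divfK// gt_eqF.
Qed.

Lemma state_eq (u w : state R) : Omega u -> Omega w ->
  lrho u = lrho w -> velocity u = velocity w -> u = w.
Proof. by move=> u0 w0 cE vE; rewrite -(mkst_lrho u0) cE vE mkst_lrho. Qed.

Lemma lrho_lt (u w : state R) : Omega u -> Omega w ->
  (lrho u < lrho w) = (u.1 < w.1).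
Proof. by move=> u0 w0; rewrite ltr_pM2l// ltr_ln. Qed.

Lemma lrho_le (u w : state R) : Omega u -> Omega w ->
  (lrho u <= lrho w) = (u.1 <= w.1).
Proof. by move=> u0 w0; rewrite !leNgt lrho_lt. Qed.

Lemma momentumE (u : state R) : Omega u -> u.2 = velocity u * u.1.
Proof. by move=> u0; rewrite /velocity divfK// gt_eqF. Qed.

Lemma velocity_eq0 (u : state R) : Omega u -> (velocity u == 0) = (u.2 == 0).
Proof. by move=> u0; rewrite mulf_eq0 invr_eq0 (gt_eqF u0) orbF. Qed.

Lemma velocity_ge0 (u : state R) : Omega u -> (0 <= velocity u) = (0 <= u.2).
Proof. by move=> u0; rewrite ler_pdivlMr// mul0r. Qed.

Lemma velocity_le0 (u : state R) : Omega u -> (velocity u <= 0) = (u.2 <= 0).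
Proof. by move=> u0; rewrite ler_pdivrMr// mul0r. Qed.

Lemma lrhoB (u w : state R) : Omega u -> Omega w ->
  a * ln (w.1 / u.1) = lrho w - lrho u.
Proof. by move=> u0 w0; rewrite ln_div// mulrBr. Qed.

(** The square roots in [S1] and [S2] halve the logarithm, hence the argument s / (2 a) in [lax]. *)
Lemma sqrt_densE (u w : state R) : Omega u -> Omega w ->
  Num.sqrt (w.1 / u.1) = expR ((lrho w - lrho u) / (2 * a)).
Proof.
move=> u0 w0; rewrite -lrhoB//.
have -> : a * ln (w.1 / u.1) / (2 * a) = ln (w.1 / u.1) / 2 by field.
rewrite -{1}[w.1 / u.1]lnK ?posrE ?divr_gt0//.
set x := ln _; have -> : expR x = expR (x / 2) ^+ 2.
  by rewrite -expRM_natl; congr expR; field.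
by rewrite sqrtr_sqr ger0_norm// expR_ge0.
Qed.

Lemma lax_shockE (u w : state R) : Omega u -> Omega w -> u.1 < w.1 ->
  lax (lrho w - lrho u) =
  a * (Num.sqrt (w.1 / u.1) - Num.sqrt (u.1 / w.1)).
Proof.
move=> u0 w0 uw; rewrite !sqrt_densE// lax_pos; last first.
  by rewrite subr_ge0 lrho_le// ltW.
by rewrite -[lrho u - lrho w]opprB mulNr.
Qed.

Lemma lax_rarefE (u w : state R) : Omega u -> Omega w -> w.1 <= u.1 ->
  lax (lrho w - lrho u) = a * ln (w.1 / u.1).
Proof.
by move=> u0 w0 wu; rewrite lrhoB// lax_npos// subr_le0 lrho_le.
Qed.

(* [w] is reached from [u] along the forward 1-curve [FL1], resp. along the
   forward 2-curve, that is [u] is on the curve [BL2] of [w]. *)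
Definition link1 (u w : state R) : Prop :=
  velocity w = velocity u - lax (lrho w - lrho u).

Definition link2 (u w : state R) : Prop :=
  velocity u = velocity w + lax (lrho u - lrho w).

Lemma FL1E (u w : state R) : Omega u -> FL1 a u w <-> Omega w /\ link1 u w.
Proof.
move=> u0; suff e : 0 < w.1 ->
    (w.2 = (if w.1 <= u.1 then R1 a w.1 u else S1 a w.1 u)) <-> link1 u w.
  by split=> -[w0 /(e w0)].
move=> w0; have -> : (if w.1 <= u.1 then R1 a w.1 u else S1 a w.1 u) =
    w.1 * (velocity u - lax (lrho w - lrho u)).
  by case: leP => h; [rewrite lax_rarefE|rewrite lax_shockE].
rewrite /link1 momentumE// mulrC; split=> [|->//].
by move/mulfI; apply; rewrite gt_eqF.
Qed.

Lemma BL2E (u w : state R) : Omega w -> BL2 a w u <-> Omega u /\ link2 u w.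
Proof.
move=> w0; suff e : 0 < u.1 ->
    (u.2 = (if u.1 <= w.1 then R2 a u.1 w else S2 a u.1 w)) <-> link2 u w.
  by split=> -[u0 /(e u0)].
move=> u0; have -> : (if u.1 <= w.1 then R2 a u.1 w else S2 a u.1 w) =
    u.1 * (velocity w + lax (lrho u - lrho w)).
  by case: leP => h; [rewrite lax_rarefE|rewrite lax_shockE].
rewrite /link2 momentumE// mulrC; split=> [|->//].
by move/mulfI; apply; rewrite gt_eqF.
Qed.

Lemma link1_refl u : link1 u u.
Proof. by rewrite /link1 subrr lax0 subr0. Qed.

Lemma link2_refl u : link2 u u.
Proof. by rewrite /link2 subrr lax0 addr0. Qed.

(** Eliminating the velocity from the two links leaves lax (c - c_l) + lax (c - c_r) = v_l - v_r,
    whose left side is strictly increasing in c. In this form, exhibiting a state with both links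
    identifies the middle state, which is how truncated data are treated. *)
Lemma utilde_uniq (ul ur w : state R) : Omega ul -> Omega ur -> Omega w ->
  link1 ul w -> link2 w ur -> utilde a ul ur = w.
Proof.
move=> l0 r0 w0 lw wr; rewrite /utilde; case: xgetP => [x _ | /(_ w)]; last first.
  by move=> []; split; [apply/FL1E|apply/BL2E].
move=> -[/(FL1E _ l0)[x0 lx] /(BL2E _ r0)[_ xr]].
suff cE : lrho x = lrho w by apply: state_eq => //; rewrite lx lw cE.
move: lx xr lw wr; rewrite /link1 /link2 => -> ex -> ew; apply: le_anti.
case: (ltgtP (lrho x) (lrho w)) => // h.
- have : lax (lrho x - lrho ul) < lax (lrho w - lrho ul).
    by rewrite lax_lt ltrD2r.
  have : lax (lrho x - lrho ur) < lax (lrho w - lrho ur).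
    by rewrite lax_lt ltrD2r.
  lra.
- have : lax (lrho w - lrho ul) < lax (lrho x - lrho ul).
    by rewrite lax_lt ltrD2r.
  have : lax (lrho w - lrho ur) < lax (lrho x - lrho ur).
    by rewrite lax_lt ltrD2r.
  lra.
Qed.

Lemma utildeP (ul ur : state R) : Omega ul -> Omega ur ->
  [/\ Omega (utilde a ul ur), link1 ul (utilde a ul ur)
    & link2 (utilde a ul ur) ur].
Proof.
move=> l0 r0.
(* The middle coordinate solves [f c] = v_l - v_r; a sum of two expanding functions is expanding,
   hence onto. *)
pose f c := lax (c - lrho ul) + lax (c - lrho ur).
have cf : continuous f.
  by move=> c; apply: cvgD; apply: continuous_cvg;
    [exact: lax_continuous|apply: cvgB; [exact: cvg_id|exact: cvg_cst]|
     exact: lax_continuous|apply: cvgB; [exact: cvg_id|exact: cvg_cst]].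
have ef s t : s <= t -> t - s <= f t - f s.
  move=> st; rewrite /f.
  have /lax_expand : s - lrho ul <= t - lrho ul by rewrite lerD2r.
  have /lax_expand : s - lrho ur <= t - lrho ur by rewrite lerD2r.
  lra.
have [c fc] := expanding_surj cf ef (velocity ul - velocity ur).
pose w := mkst c (velocity ul - lax (c - lrho ul)).
have lw : link1 ul w by rewrite /link1 velocity_mkst lrho_mkst.
have wr : link2 w ur.
  by rewrite /link2 velocity_mkst lrho_mkst; rewrite /f in fc; lra.
by rewrite (utilde_uniq l0 r0 (Omega_mkst _ _) lw wr); split => //; exact: Omega_mkst.
Qed.

Definition hatc (u : state R) : R := lrho u + laxV (velocity u).

Definition checkc (u : state R) : R := lrho u + laxV (- velocity u).

Lemma link1_hat (u : state R) : link1 u (mkst (hatc u) 0).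
Proof.
by rewrite /link1 velocity_mkst lrho_mkst /hatc [lrho u + _]addrC addrK laxVK subrr.
Qed.

Lemma link2_check (u : state R) : link2 (mkst (checkc u) 0) u.
Proof.
by rewrite /link2 velocity_mkst lrho_mkst /checkc [lrho u + _]addrC addrK laxVK subrr.
Qed.

Lemma uhatE (u : state R) : Omega u -> uhat a u = mkst (hatc u) 0.
Proof.
move=> u0; have lw := link1_hat u.
rewrite /uhat; case: xgetP => [x _ | /(_ (mkst (hatc u) 0))]; last first.
  by case; split; [apply/FL1E => //; split => //; exact: Omega_mkst|rewrite /= mul0r].
move=> -[/(FL1E _ u0)[x0 lx] /eqP]; rewrite -velocity_eq0// => /eqP vx.
apply: state_eq => //; first exact: Omega_mkst; last by rewrite velocity_mkst.
move: lx; rewrite /link1 vx lrho_mkst /hatc => /esym/subr0_eq ->.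
by rewrite laxK addrC subrK.
Qed.

Lemma ucheckE (u : state R) : Omega u -> ucheck a u = mkst (checkc u) 0.
Proof.
move=> u0; have lw := link2_check u.
rewrite /ucheck; case: xgetP => [x _ | /(_ (mkst (checkc u) 0))]; last first.
  by case; split; [apply/BL2E => //; split => //; exact: Omega_mkst|rewrite /= mul0r].
move=> -[/(BL2E _ u0)[x0 lx] /eqP]; rewrite -velocity_eq0// => /eqP vx.
apply: state_eq => //; first exact: Omega_mkst; last by rewrite velocity_mkst.
move: lx; rewrite /link2 vx lrho_mkst /checkc => /esym/eqP.
by rewrite addr_eq0 => /eqP ->; rewrite opprK laxK addrC subrK.
Qed.

(** * Point values of shocks and rarefactions *)

Definition clamp (x y t : R) : R := Num.max x (Num.min y t).

(** Parametrization by the velocity is chosen because, on the ray xi, the condition lambda_1 = xi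
    reads V = xi + a, while c + v keeps its value at [u]. *)
Definition raref1 (u : state R) (V : R) : state R :=
  mkst (lrho u + velocity u - V) V.

Definition raref2 (u : state R) (V : R) : state R :=
  mkst (lrho u - velocity u + V) V.

Lemma shock_densE (u w : state R) : Omega u -> Omega w ->
  w.1 = u.1 * expR ((lrho w - lrho u) / (2 * a)) ^+ 2.
Proof.
move=> u0 w0; rewrite -sqrt_densE// sqr_sqrtr ?divr_ge0 ?ltW//.
by rewrite mulrC divfK// gt_eqF.
Qed.

Lemma raref_state1E (u : state R) (xi : R) : Omega u ->
  raref_state (lambda1 a) (R1 a) u xi = raref1 u (xi + a).
Proof.
move=> u0; pose w := raref1 u (xi + a).
have w0 : Omega w by exact: Omega_mkst.
have R1E x : Omega x -> x.2 = R1 a x.1 u ->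
    velocity x = velocity u - (lrho x - lrho u).
  move=> x0; rewrite momentumE// /R1 lrhoB// mulrC => /mulfI; apply.
  by rewrite gt_eqF.
rewrite /raref_state; case: xgetP => [x _ [x0 /(R1E _ x0) vx lx]|/(_ w)].
  have {}lx : velocity x = xi + a by rewrite -lx /lambda1 subrK.
  apply: state_eq => //; rewrite ?velocity_mkst// lrho_mkst -lx.
  by rewrite vx; ring.
case; split => //; last by rewrite /lambda1 velocity_mkst addrK.
rewrite momentumE// /R1 lrhoB// mulrC velocity_mkst lrho_mkst; congr *%R; ring.
Qed.

Lemma raref_state2E (u : state R) (xi : R) : Omega u ->
  raref_state (lambda2 a) (R2 a) u xi = raref2 u (xi - a).
Proof.
move=> u0; pose w := raref2 u (xi - a).
have w0 : Omega w by exact: Omega_mkst.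
have R2E x : Omega x -> x.2 = R2 a x.1 u ->
    velocity x = velocity u + (lrho x - lrho u).
  move=> x0; rewrite momentumE// /R2 lrhoB// mulrC => /mulfI; apply.
  by rewrite gt_eqF.
rewrite /raref_state; case: xgetP => [x _ [x0 /(R2E _ x0) vx lx]|/(_ w)].
  have {}lx : velocity x = xi - a by rewrite -lx /lambda2 addrK.
  apply: state_eq => //; rewrite ?velocity_mkst// lrho_mkst -lx.
  by rewrite vx; ring.
case; split => //; last by rewrite /lambda2 velocity_mkst subrK.
rewrite momentumE// /R2 lrhoB// mulrC velocity_mkst lrho_mkst; congr *%R; ring.
Qed.

Lemma raref1_self (u : state R) : Omega u -> raref1 u (velocity u) = u.
Proof. by move=> u0; rewrite /raref1 addrK mkst_lrho. Qed.

Lemma raref2_self (u : state R) : Omega u -> raref2 u (velocity u) = u.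
Proof. by move=> u0; rewrite /raref2 subrK mkst_lrho. Qed.

Lemma clamp_id x t : clamp x x t = x.
Proof. by rewrite /clamp max_l// ge_min lexx. Qed.

Lemma raref1_link (u w : state R) : Omega u -> Omega w -> link1 u w ->
  lrho w <= lrho u -> raref1 u (velocity w) = w.
Proof.
move=> u0 w0 uw wu; apply: state_eq => //; first exact: Omega_mkst.
  by rewrite lrho_mkst uw lax_npos ?subr_le0//; ring.
by rewrite velocity_mkst.
Qed.

Lemma raref2_link (u w : state R) : Omega u -> Omega w -> link2 u w ->
  lrho u <= lrho w -> raref2 u (velocity w) = w.
Proof.
move=> u0 w0 uw wu; apply: state_eq => //; first exact: Omega_mkst.
  by rewrite lrho_mkst uw lax_npos ?subr_le0//; ring.
by rewrite velocity_mkst.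
Qed.

Lemma link1_le (u w : state R) : link1 u w ->
  (velocity u <= velocity w) = (lrho w <= lrho u).
Proof.
by move=> ->; rewrite -subr_ge0 addrC addKr oppr_ge0 -lax0 lax_le subr_le0.
Qed.

Lemma link2_le (u w : state R) : link2 u w ->
  (velocity u <= velocity w) = (lrho u <= lrho w).
Proof. by move=> ->; rewrite gerDl -[X in (_ <= X) = _]lax0 lax_le subr_le0. Qed.

(** [clamp] merges the three branches of a fan into one continuous formula. The constant wave is the
    fan over a degenerate velocity interval, so the test [um == up] disappears. *)
Lemma wave1E (um up : state R) (xi : R) : Omega um -> Omega up -> link1 um up ->
  wave1 a um up xi = if lrho um < lrho up then
    if xi < velocity um - shock_gap (lrho up - lrho um) then um else up
  else raref1 um (clamp (velocity um) (velocity up) (xi + a)).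
Proof.
move=> m0 p0 mp; rewrite /wave1 /wave -lrho_lt//.
have [eq_mp|neq] := eqVneq um up.
  by rewrite -eq_mp ltxx clamp_id raref1_self.
case: ifPn => [shock|]; last rewrite -leNgt => raref.
  congr (if _ < _ then _ else _).
  (* With E = exp (s / (2 a)), where s is the increase of the coordinate, the density ratio is E ^ 2
     and the velocity drop a (E - 1 / E). The Rankine-Hugoniot quotient then reduces to v_- - a E,
     on division by E ^ 2 - 1 > 0. *)
  have := shock_densE m0 p0; have := lax_pos; rewrite !momentumE// mp.
  have s0 : 0 < lrho up - lrho um by rewrite subr_gt0.
  rewrite lax_pos ?(ltW s0)// /shock_gap; set s := (_ - _) / _ => _ pE.
  have : 1 < expR s by rewrite -(@expR0 R) ltr_expR divr_gt0// mulr_gt0.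
  rewrite expRN pE; set E := expR s => E1; field.
  rewrite !gt_eqF//; first by apply: lt_trans E1.
  rewrite -[X in _ - X]mulr1 -mulrBr mulr_gt0// subr_gt0 expr_gt1//.
  by apply: ltW; apply: lt_trans E1.
rewrite /clamp /lambda1.
have le_mp : velocity um <= velocity up by rewrite link1_le.
case: ltP => h1.
  by rewrite max_l ?raref1_self// ge_min; apply/orP; right; lra.
case: ltP => h2.
  by rewrite min_l ?max_r// ?raref1_link//; lra.
by rewrite raref_state1E// min_r ?max_r//; lra.
Qed.

Lemma wave2E (um up : state R) (xi : R) : Omega um -> Omega up -> link2 um up ->
  wave2 a um up xi = if lrho up < lrho um then
    if xi < velocity up + shock_gap (lrho um - lrho up) then um else up
  else raref2 um (clamp (velocity um) (velocity up) (xi - a)).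
Proof.
move=> m0 p0 mp; rewrite /wave2 /wave -lrho_lt//.
have [eq_mp|neq] := eqVneq um up.
  by rewrite -eq_mp ltxx clamp_id raref2_self.
case: ifPn => [shock|]; last rewrite -leNgt => raref.
  congr (if _ < _ then _ else _).
  have := shock_densE p0 m0; have := lax_pos; rewrite !momentumE// mp.
  have s0 : 0 < lrho um - lrho up by rewrite subr_gt0.
  rewrite lax_pos ?(ltW s0)// /shock_gap; set s := (_ - _) / _ => _ pE.
  have : 1 < expR s by rewrite -(@expR0 R) ltr_expR divr_gt0// mulr_gt0.
  rewrite expRN pE; set E := expR s => E1; field.
  rewrite lt_eqF ?gt_eqF//; first by apply: lt_trans E1.
  rewrite subr_lt0 -[X in X < _]mulr1 ltr_pM2l// expr_gt1//.
  by apply: ltW; apply: lt_trans E1.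
rewrite /clamp /lambda2.
have le_mp : velocity um <= velocity up by rewrite link2_le.
case: ltP => h1.
  by rewrite max_l ?raref2_self// ge_min; apply/orP; right; lra.
case: ltP => h2.
  by rewrite min_l ?max_r// ?raref2_link//; lra.
by rewrite raref_state2E// min_r ?max_r//; lra.
Qed.

Lemma clampE x y t : x <= y ->
  clamp x y t = if t < x then x else if y < t then y else t.
Proof.
move=> xy; rewrite /clamp; case: (ltP t x) => tx.
  by rewrite max_l// ge_min (ltW tx) orbT.
by case: (ltP y t) => yt; rewrite max_r// le_min xy.
Qed.

Lemma clamp_bounds x y t : x <= y -> x <= clamp x y t <= y.
Proof. by move=> xy; rewrite clampE//; case: ltP => ?; [|case: ltP => ?]; lra. Qed.

(** A fan cut at [s] is the fan over the shortened velocity interval, continued by a constant. *)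
Lemma clamp_clamp_le x y s t : x <= y ->
  clamp x (clamp x y s) t = if t < s then clamp x y t else clamp x y s.
Proof.
move=> xy; rewrite clampE; last by have /andP[] := clamp_bounds s xy.
rewrite !clampE//; case: (ltP s x) => ?; case: (ltP y s) => ?;
  case: (ltP t x) => ?; case: (ltP y t) => ?; case: (ltP t s) => ? //;
  do ?[case: ltP => ? //]; lra.
Qed.

Lemma clamp_clamp_ge x y s t : x <= y ->
  clamp (clamp x y s) y t = if t < s then clamp x y s else clamp x y t.
Proof.
move=> xy; rewrite clampE; last by have /andP[] := clamp_bounds s xy.
rewrite !clampE//; case: (ltP s x) => ?; case: (ltP y s) => ?;
  case: (ltP t x) => ?; case: (ltP y t) => ?; case: (ltP t s) => ? //;
  do ?[case: ltP => ? //]; lra.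
Qed.

Lemma lrho_raref1 u V : lrho (raref1 u V) = lrho u + velocity u - V.
Proof. exact: lrho_mkst. Qed.

Lemma lrho_raref2 u V : lrho (raref2 u V) = lrho u - velocity u + V.
Proof. exact: lrho_mkst. Qed.

Lemma velocity_raref1 u V : velocity (raref1 u V) = V.
Proof. exact: velocity_mkst. Qed.

Lemma velocity_raref2 u V : velocity (raref2 u V) = V.
Proof. exact: velocity_mkst. Qed.

Lemma raref1_raref1 u V V' : raref1 (raref1 u V) V' = raref1 u V'.
Proof. by rewrite {1}/raref1 lrho_raref1 velocity_raref1 subrK. Qed.

Lemma raref2_raref2 u V V' : raref2 (raref2 u V) V' = raref2 u V'.
Proof. by rewrite {1}/raref2 lrho_raref2 velocity_raref2 addrK. Qed.

Lemma link1_raref1 u V : velocity u <= V -> link1 u (raref1 u V).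
Proof.
by move=> uV; rewrite /link1 lrho_raref1 velocity_raref1 lax_npos; lra.
Qed.

Lemma link2_raref2 u V : velocity u <= V -> link2 u (raref2 u V).
Proof.
by move=> uV; rewrite /link2 lrho_raref2 velocity_raref2 lax_npos; lra.
Qed.

Section Wave.
Variables (um up : state R).
Hypotheses (m0 : Omega um) (p0 : Omega up).

(** The fan case also covers the constant wave; it carries the Riemann invariant in linear form,
    ready for [lra]. *)
Variant wave1_spec (xi : R) : bool -> state R -> Type :=
| Wave1Left of lrho um < lrho up &
    xi < velocity um - shock_gap (lrho up - lrho um) : wave1_spec xi true um
| Wave1Right of lrho um < lrho up &
    velocity um - shock_gap (lrho up - lrho um) <= xi : wave1_spec xi true up
| Wave1Raref of lrho up <= lrho um & velocity um <= velocity up &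
    lrho up + velocity up = lrho um + velocity um :
    wave1_spec xi false (raref1 um (clamp (velocity um) (velocity up) (xi + a))).

Lemma wave1P xi : link1 um up ->
  wave1_spec xi (lrho um < lrho up) (wave1 a um up xi).
Proof.
move=> mp; rewrite wave1E//; case: ltP => [shock|raref].
  by case: ltP => h; constructor.
have le_mp : velocity um <= velocity up by rewrite link1_le.
by constructor => //; rewrite mp lax_npos; lra.
Qed.

Variant wave2_spec (xi : R) : bool -> state R -> Type :=
| Wave2Left of lrho up < lrho um &
    xi < velocity up + shock_gap (lrho um - lrho up) : wave2_spec xi true um
| Wave2Right of lrho up < lrho um &
    velocity up + shock_gap (lrho um - lrho up) <= xi : wave2_spec xi true up
| Wave2Raref of lrho um <= lrho up & velocity um <= velocity up &
    lrho up - velocity up = lrho um - velocity um :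
    wave2_spec xi false (raref2 um (clamp (velocity um) (velocity up) (xi - a))).

Lemma wave2P xi : link2 um up ->
  wave2_spec xi (lrho up < lrho um) (wave2 a um up xi).
Proof.
move=> mp; rewrite wave2E//; case: ltP => [shock|raref].
  by case: ltP => h; constructor.
have le_mp : velocity um <= velocity up by rewrite link2_le.
by constructor => //; rewrite mp lax_npos; lra.
Qed.

(** A shock takes only its end values, and a state inside a fan is joined to both ends by
    rarefactions. Cutting a wave therefore preserves the links to what remains. *)
Lemma wave1_link xi : link1 um up ->
  [/\ Omega (wave1 a um up xi), link1 um (wave1 a um up xi)
    & link1 (wave1 a um up xi) up].
Proof.
move=> mp; case: wave1P => // [_ _|_ _|c v cv].
- by split=> //; exact: link1_refl.
- by split=> //; exact: link1_refl.
have /andP[V1 V2] := clamp_bounds (xi + a) v.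
split; [exact: Omega_mkst|exact: link1_raref1|].
by rewrite /link1 lrho_raref1 velocity_raref1 lax_npos; lra.
Qed.

Lemma wave2_link xi : link2 um up ->
  [/\ Omega (wave2 a um up xi), link2 um (wave2 a um up xi)
    & link2 (wave2 a um up xi) up].
Proof.
move=> mp; case: wave2P => // [_ _|_ _|c v cv].
- by split=> //; exact: link2_refl.
- by split=> //; exact: link2_refl.
have /andP[V1 V2] := clamp_bounds (xi - a) v.
split; [exact: Omega_mkst|exact: link2_raref2|].
by rewrite /link2 lrho_raref2 velocity_raref2 lax_npos; lra.
Qed.

(** A 1-wave lags behind the fluid: v = xi + a inside a fan, and a shock speed lies below the
    velocity on its left. So a cut inside the 1-wave leaves the new middle velocity beyond the ray
    of the cut. *)
Lemma wave1_faster xi : link1 um up ->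
  xi < velocity up -> xi < velocity (wave1 a um up xi).
Proof.
move=> mp xiV; case: wave1P => // [_ h|c v cv].
  by have := shock_gap_gt0 (lrho up - lrho um); lra.
by have a0 := a_gt0; rewrite velocity_raref1 clampE//; case: (ltP _ (velocity um)) => ?;
  [|case: (ltP (velocity up)) => ?]; lra.
Qed.

Lemma wave2_slower xi : link2 um up ->
  velocity um <= xi -> velocity (wave2 a um up xi) <= xi.
Proof.
move=> mp xiV; case: wave2P => // [_ h|c v cv].
  by have := shock_gap_gt0 (lrho um - lrho up); lra.
by have a0 := a_gt0; rewrite velocity_raref2 clampE//; case: (ltP _ (velocity um)) => ?;
  [|case: (ltP (velocity up)) => ?]; lra.
Qed.

End Wave.

Lemma wave1_const u xi : wave1 a u u xi = u.
Proof. by rewrite /wave1 /wave eqxx. Qed.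

Lemma wave2_const u xi : wave2 a u u xi = u.
Proof. by rewrite /wave2 /wave eqxx. Qed.

(** * Truncation of waves and consistence of [RSp] *)

Lemma wave1_trunc_right (um up : state R) (xio xi : R) :
  Omega um -> Omega up -> link1 um up ->
  wave1 a um (wave1 a um up xio) xi =
  if xi < xio then wave1 a um up xi else wave1 a um up xio.
Proof.
move=> m0 p0 mp; have [w0 mw wp] := wave1_link m0 p0 xio mp.
move: w0 mw wp; rewrite ![wave1 a um up _]wave1E//.
case: ltP => [shock|raref].
  case: ltP => ho.
    by rewrite wave1_const => _ _ _; case: (ltP xi) => // h; rewrite ifT//; lra.
  rewrite wave1E// shock => _ _ _; case: (ltP xi xio) => // h.
  by rewrite ifF//; apply/negbTE; lra.
move=> w0 mw wp; rewrite wave1E//.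
have le_mp : velocity um <= velocity up by rewrite link1_le.
have /andP[V1 V2] := clamp_bounds (xio + a) le_mp.
rewrite lrho_raref1 velocity_raref1 ifF; last by apply/negbTE; lra.
rewrite clamp_clamp_le// ltrD2r; by case: ifP.
Qed.

Lemma wave1_trunc_left (um up : state R) (xio xi : R) :
  Omega um -> Omega up -> link1 um up ->
  wave1 a (wave1 a um up xio) up xi =
  if xi < xio then wave1 a um up xio else wave1 a um up xi.
Proof.
move=> m0 p0 mp; have [w0 mw wp] := wave1_link m0 p0 xio mp.
move: w0 mw wp; rewrite ![wave1 a um up _]wave1E//.
case: ltP => [shock|raref].
  case: ltP => ho.
    rewrite wave1E// shock => _ _ _; case: (ltP xi xio) => // h.
    by rewrite ifT//; lra.
  rewrite wave1_const => _ _ _; case: (ltP xi xio) => // h.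
  by rewrite ifF//; apply/negbTE; lra.
move=> w0 mw wp; rewrite wave1E//.
have le_mp : velocity um <= velocity up by rewrite link1_le.
have cv : lrho up + velocity up = lrho um + velocity um.
  by rewrite mp lax_npos; lra.
have /andP[V1 V2] := clamp_bounds (xio + a) le_mp.
rewrite lrho_raref1 velocity_raref1 ifF; last by apply/negbTE; lra.
rewrite clamp_clamp_ge// ltrD2r raref1_raref1; by case: ifP.
Qed.

Lemma wave2_trunc_right (um up : state R) (xio xi : R) :
  Omega um -> Omega up -> link2 um up ->
  wave2 a um (wave2 a um up xio) xi =
  if xi < xio then wave2 a um up xi else wave2 a um up xio.
Proof.
move=> m0 p0 mp; have [w0 mw wp] := wave2_link m0 p0 xio mp.
move: w0 mw wp; rewrite ![wave2 a um up _]wave2E//.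
case: ltP => [shock|raref].
  case: ltP => ho.
    by rewrite wave2_const => _ _ _; case: (ltP xi) => // h; rewrite ifT//; lra.
  rewrite wave2E// shock => _ _ _; case: (ltP xi xio) => // h.
  by rewrite ifF//; apply/negbTE; lra.
move=> w0 mw wp; rewrite wave2E//.
have le_mp : velocity um <= velocity up by rewrite link2_le.
have /andP[V1 V2] := clamp_bounds (xio - a) le_mp.
rewrite lrho_raref2 velocity_raref2 ifF; last by apply/negbTE; lra.
rewrite clamp_clamp_le// ltrD2r; by case: ifP.
Qed.

Lemma wave2_trunc_left (um up : state R) (xio xi : R) :
  Omega um -> Omega up -> link2 um up ->
  wave2 a (wave2 a um up xio) up xi =
  if xi < xio then wave2 a um up xio else wave2 a um up xi.
Proof.
move=> m0 p0 mp; have [w0 mw wp] := wave2_link m0 p0 xio mp.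
move: w0 mw wp; rewrite ![wave2 a um up _]wave2E//.
case: ltP => [shock|raref].
  case: ltP => ho.
    rewrite wave2E// shock => _ _ _; case: (ltP xi xio) => // h.
    by rewrite ifT//; lra.
  rewrite wave2_const => _ _ _; case: (ltP xi xio) => // h.
  by rewrite ifF//; apply/negbTE; lra.
move=> w0 mw wp; rewrite wave2E//.
have le_mp : velocity um <= velocity up by rewrite link2_le.
have cv : lrho up - velocity up = lrho um - velocity um.
  by rewrite mp lax_npos; lra.
have /andP[V1 V2] := clamp_bounds (xio - a) le_mp.
rewrite lrho_raref2 velocity_raref2 ifF; last by apply/negbTE; lra.
rewrite clamp_clamp_ge// ltrD2r raref2_raref2; by case: ifP.
Qed.

(** A cut before the middle velocity makes the value at the cut the new middle state, with a trivial
    2-wave; a later cut keeps the old middle state. *)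
Lemma RSp_trunc_right (ul ur : state R) (xio xi : R) : Omega ul -> Omega ur ->
  RSp a ul (RSp a ul ur xio) xi =
  if xi < xio then RSp a ul ur xi else RSp a ul ur xio.
Proof.
move=> l0 r0; have [t0 lt tr] := utildeP l0 r0.
rewrite {2 4}/RSp; case: ltP => ho.
  have [w0 lw wt] := wave1_link l0 t0 xio lt.
  rewrite /RSp (utilde_uniq l0 w0 w0 lw (link2_refl _)) wave2_const.
  rewrite wave1_trunc_right//.
  have := wave1_faster l0 t0 lt ho.
  case: (ltP xi xio) => h hw.
    by rewrite (lt_trans h hw) (lt_trans h ho).
  by case: ifP.
have [w0 tw wr] := wave2_link t0 r0 xio tr.
rewrite /RSp (utilde_uniq l0 w0 t0 lt tw) wave2_trunc_right//.
by case: (ltP xi xio) => // h; rewrite ifF// ltNge (le_trans ho h).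
Qed.

Lemma RSp_trunc_left (ul ur : state R) (xio xi : R) : Omega ul -> Omega ur ->
  RSp a (RSp a ul ur xio) ur xi =
  if xi < xio then RSp a ul ur xio else RSp a ul ur xi.
Proof.
move=> l0 r0; have [t0 lt tr] := utildeP l0 r0.
rewrite {2 3}/RSp; case: ltP => ho.
  have [w0 lw wt] := wave1_link l0 t0 xio lt.
  rewrite /RSp (utilde_uniq w0 r0 t0 wt tr) wave1_trunc_left//.
  by case: (ltP xi xio) => // h; rewrite (lt_trans h ho).
have [w0 tw wr] := wave2_link t0 r0 xio tr.
rewrite /RSp (utilde_uniq w0 r0 w0 (link1_refl _) wr) wave1_const.
rewrite wave2_trunc_left//.
have := wave2_slower t0 r0 tr ho.
case: (ltP xi xio) => h hw; first by case: ifP.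
rewrite !ifF//; apply/negbTE; rewrite -leNgt; first exact: le_trans h.
exact: le_trans h.
Qed.

Lemma RSp_Omega (ul ur : state R) xi :
  Omega ul -> Omega ur -> Omega (RSp a ul ur xi).
Proof.
move=> l0 r0; have [t0 lt tr] := utildeP l0 r0; rewrite /RSp.
case: ifP => _; first by have [] := wave1_link l0 t0 xi lt.
by have [] := wave2_link t0 r0 xi tr.
Qed.

Lemma wave2_slower_lt (um up : state R) xi : Omega um -> Omega up ->
  link2 um up -> velocity um < xi -> velocity (wave2 a um up xi) < xi.
Proof.
move=> m0 p0 mp xiV; case: wave2P => // [_ h|c v cv].
  by have := shock_gap_gt0 (lrho um - lrho up); lra.
have a0 := a_gt0; rewrite velocity_raref2 clampE//.
case: (ltP _ (velocity um)) => ?; [|case: (ltP (velocity up)) => ?]; lra.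
Qed.

(** The witness is the shock speed, or lambda_1 of the right state. Together with [wave2_begin] this
    makes the solution constant around the middle velocity. *)
Lemma wave1_end (um up : state R) : Omega um -> Omega up -> link1 um up ->
  exists2 xi0, xi0 < velocity up & forall xi, xi0 < xi -> wave1 a um up xi = up.
Proof.
move=> m0 p0 mp; have a0 := a_gt0.
have [shock|raref] := ltP (lrho um) (lrho up).
  exists (velocity um - shock_gap (lrho up - lrho um)) => [|xi h].
    by rewrite mp ltrD2l ltrN2 lax_lt_gap.
  by rewrite wave1E// shock ifF//; apply/negbTE; rewrite -leNgt ltW.
exists (velocity up - a) => [|xi h]; first by rewrite gtrBl.
rewrite wave1E// ltNge raref /= clampE ?link1_le//.
have le_mp : velocity um <= velocity up by rewrite link1_le.
rewrite ifF; last by apply/negbTE; lra.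
by rewrite ifT ?raref1_link//; lra.
Qed.

Lemma wave2_begin (um up : state R) : Omega um -> Omega up -> link2 um up ->
  exists2 xi0, velocity um < xi0 & forall xi, xi < xi0 -> wave2 a um up xi = um.
Proof.
move=> m0 p0 mp; have a0 := a_gt0.
have [shock|raref] := ltP (lrho up) (lrho um).
  exists (velocity up + shock_gap (lrho um - lrho up)) => [|xi h].
    by rewrite mp ltrD2l lax_lt_gap.
  by rewrite wave2E// shock h.
exists (velocity um + a) => [|xi h]; first by rewrite ltrDl.
rewrite wave2E// ltNge raref /= clampE ?link2_le// ifT ?raref2_self//; lra.
Qed.

Lemma wave2_start (um up : state R) : Omega um -> Omega up -> link2 um up ->
  wave2 a um up (velocity um) = um.
Proof.
by move=> m0 p0 mp; have [xi0 h ->] := wave2_begin m0 p0 mp.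
Qed.

Lemma wave1_before (um up : state R) : Omega um -> Omega up -> link1 um up ->
  exists xi0, forall xi, xi < xi0 -> wave1 a um up xi = um.
Proof.
move=> m0 p0 mp.
exists (Num.min (velocity um - shock_gap (lrho up - lrho um)) (velocity um - a)).
move=> xi; rewrite lt_min => /andP[h1 h2].
case: wave1P => // [_|_ v _]; first by rewrite leNgt h1.
by rewrite clampE// ifT ?raref1_self// -ltrBrDr.
Qed.

Lemma wave2_after (um up : state R) : Omega um -> Omega up -> link2 um up ->
  exists xi0, forall xi, xi0 < xi -> wave2 a um up xi = up.
Proof.
move=> m0 p0 mp.
exists (Num.max (velocity up + shock_gap (lrho um - lrho up)) (velocity up + a)).
move=> xi; rewrite gt_max => /andP[h1 h2].
case: wave2P => // [_ /ltW|c v cv]; first by rewrite leNgt h1.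
rewrite clampE// ifF; last by apply/negbTE; lra.
by rewrite ifT ?raref2_link//; lra.
Qed.

(** On the ray 0, a value from the 1-wave has positive velocity, and a value from the 2-wave
    strictly past the middle ray has negative velocity. *)
Lemma RSp0_at_rest (ul ur : state R) : Omega ul -> Omega ur ->
  velocity (RSp a ul ur 0) = 0 -> velocity (utilde a ul ur) = 0.
Proof.
move=> l0 r0; have [t0 lt tr] := utildeP l0 r0; rewrite /RSp.
case: ltgtP => // h v0.
  by have := wave1_faster l0 t0 lt h; rewrite v0 ltxx.
by have := wave2_slower_lt t0 r0 tr h; rewrite v0 ltxx.
Qed.

(** * States at rest and the sign of the middle velocity *)

Lemma link1_gt0 (u w : state R) : link1 u w ->
  (0 < velocity w) = (lrho w < hatc u).
Proof. by move=> ->; rewrite subr_gt0 -{1}(laxVK (velocity u)) lax_lt ltrBlDl. Qed.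

Lemma link1_lt0 (u w : state R) : link1 u w ->
  (velocity w < 0) = (hatc u < lrho w).
Proof. by move=> ->; rewrite subr_lt0 -{1}(laxVK (velocity u)) lax_lt ltrBrDl. Qed.

Lemma link2_gt0 (u w : state R) : link2 w u ->
  (0 < velocity w) = (checkc u < lrho w).
Proof.
move=> ->; rewrite -ltrBlDl sub0r.
by rewrite -{1}(laxVK (- velocity u)) lax_lt ltrBrDl.
Qed.

Lemma link2_lt0 (u w : state R) : link2 w u ->
  (velocity w < 0) = (lrho w < checkc u).
Proof.
move=> ->; rewrite -ltrBrDl sub0r.
by rewrite -{1}(laxVK (- velocity u)) lax_lt ltrBlDl.
Qed.

Lemma link1_eq0 (u w : state R) : link1 u w ->
  velocity w = 0 <-> lrho w = hatc u.
Proof.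
move=> uw; move: (link1_gt0 uw) (link1_lt0 uw) => g l.
by split=> e; apply: le_anti; rewrite !leNgt; [rewrite -g -l|rewrite g l];
  rewrite e !ltxx.
Qed.

Lemma link2_eq0 (u w : state R) : link2 w u ->
  velocity w = 0 <-> lrho w = checkc u.
Proof.
move=> uw; move: (link2_gt0 uw) (link2_lt0 uw) => g l.
by split=> e; apply: le_anti; rewrite !leNgt; [rewrite -g -l|rewrite g l];
  rewrite e !ltxx.
Qed.

Lemma utilde_at_rest (ul ur : state R) : Omega ul -> Omega ur ->
  velocity (utilde a ul ur) = 0 <-> checkc ur = hatc ul.
Proof.
move=> l0 r0; have [t0 lt tr] := utildeP l0 r0; split=> [v0|e].
  by have /(link1_eq0 lt) <- := v0; have /(link2_eq0 tr) <- := v0.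
(* When the two coordinates agree, a nonzero middle velocity of either sign would place the middle
   coordinate both above and below the common value. *)
have := link1_gt0 lt; have := link2_gt0 tr; rewrite e => -> h.
have := link1_lt0 lt; have := link2_lt0 tr; rewrite e => -> h'.
by apply/(link1_eq0 lt); move: h h'; case: ltgtP.
Qed.

Lemma hatc_rest c : hatc (mkst c 0) = c.
Proof. by rewrite /hatc lrho_mkst velocity_mkst laxV0 addr0. Qed.

Lemma checkc_rest c : checkc (mkst c 0) = c.
Proof. by rewrite /checkc lrho_mkst velocity_mkst oppr0 laxV0 addr0. Qed.

Lemma RSp_hat (u : state R) xi : Omega u -> xi < 0 ->
  RSp a u (mkst (hatc u) 0) xi = wave1 a u (mkst (hatc u) 0) xi.
Proof.
move=> u0 xi0; rewrite /RSp.
rewrite (utilde_uniq u0 (Omega_mkst _ _) (Omega_mkst _ _)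
  (link1_hat u) (link2_refl _)).
by rewrite velocity_mkst xi0.
Qed.

Lemma RSp_check (u : state R) xi : Omega u -> 0 <= xi ->
  RSp a (mkst (checkc u) 0) u xi = wave2 a (mkst (checkc u) 0) u xi.
Proof.
move=> u0 xi0; rewrite /RSp.
rewrite (utilde_uniq (Omega_mkst _ _) u0 (Omega_mkst _ _)
  (link1_refl _) (link2_check _)).
by rewrite velocity_mkst ltNge xi0.
Qed.

(** * The valve sets in terms of [hatc] and [checkc] *)

Section Valve.
Variable M : R.
Hypothesis M_gt0 : 0 < M.

Definition far (x y : R) : bool :=
  M < a ^+ 2 * `|expR (x / a) - expR (y / a)|.

(** This is [valveAIc] on coordinates: equality is a closed valve without effect, [far] an open
    valve. *)
Definition apart (x y : R) : Prop := x = y \/ far x y.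

Lemma far_sym x y : far x y = far y x.
Proof. by rewrite /far distrC. Qed.

Lemma far_irr x : far x x = false.
Proof. by rewrite /far subrr normr0 mulr0 ltNge ltW. Qed.

Lemma far_mono x y x' y' : x' <= x -> x <= y -> y <= y' -> far x y -> far x' y'.
Proof.
move=> xx xy yy; rewrite /far => /lt_le_trans; apply.
rewrite ler_pM2l ?exprn_gt0//.
have mE s t : s <= t -> expR (s / a) <= expR (t / a).
  by move=> st; rewrite ler_expR ler_pM2r ?invr_gt0.
have := mE _ _ xx; have := mE _ _ xy; have := mE _ _ yy => h1 h2 h3.
by rewrite !ler0_norm ?subr_le0//; lra.
Qed.

Lemma apart_far x y : x != y -> apart x y -> far x y.
Proof. by move=> /eqP + [|]. Qed.

(** Continuity of exp and [M > 0]. It serves to produce coordinates that are distinct but not [far],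
    hence not [apart]. *)
Lemma near_not_far h :
  exists2 e, 0 < e & forall d, `|d| <= e -> ~~ far (h + d) h.
Proof.
pose f d := a ^+ 2 * `|expR ((h + d) / a) - expR (h / a)|.
have f0 : f 0 = 0 by rewrite /f addr0 subrr normr0 mulr0.
have cf : f d @[d --> (0:R)] --> f 0.
  apply: cvgM; first exact: cvg_cst.
  apply: cvg_norm; apply: cvgB; last exact: cvg_cst.
  apply: continuous_cvg; first exact: continuous_expR.
  by apply: cvgM; [apply: cvgD; [exact: cvg_cst|exact: cvg_id]|exact: cvg_cst].
have : \forall d \near (0:R), f d < M by apply: (cvgr_lt _ cf); rewrite f0.
move=> /nbhs_ballP[e /= e0 he]; exists (e / 2); first exact: divr_gt0.
move=> d de; rewrite -leNgt; apply/ltW/he; rewrite /ball /= sub0r normrN.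
by apply: le_lt_trans de _; rewrite ltr_pdivrMr// ltr_pMr// ltr1n.
Qed.

Lemma pressure_jumpE (ul ur : state R) : Omega ul -> Omega ur ->
  pressure_jump a ul ur =
  a ^+ 2 * `|expR (checkc ur / a) - expR (hatc ul / a)|.
Proof.
move=> l0 r0; rewrite /pressure_jump uhatE// ucheckE// /pressure /=.
by rewrite -mulrBr normrM ger0_norm// sqr_ge0.
Qed.

Lemma valveAP (ul ur : state R) : Omega ul -> Omega ur ->
  valveA a M (ul, ur) <-> far (checkc ur) (hatc ul) = false.
Proof.
move=> l0 r0; rewrite /far -pressure_jumpE// ltNge.
by split=> [[_ /= ->]//|/negbFE h]; split.
Qed.

Lemma valveOP (ul ur : state R) : Omega ul -> Omega ur ->
  valveO a M (ul, ur) <-> far (checkc ur) (hatc ul).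
Proof.
move=> l0 r0; split=> [[_ O]|f].
  by apply/negPn/negP => /negbTE /(valveAP l0 r0).
by split; [split|move/(valveAP l0 r0); rewrite f].
Qed.

Lemma RSv_A (ul ur : state R) xi : valveA a M (ul, ur) ->
  RSv a M ul ur xi = if xi < 0 then wave1 a ul (mkst (hatc ul) 0) xi
                     else wave2 a (mkst (checkc ur) 0) ur xi.
Proof.
move=> A; have [[l0 r0] _] := A; rewrite /RSv asboolT// uhatE// ucheckE//.
by case: ltP => h; [exact: RSp_hat|exact: RSp_check].
Qed.

Lemma RSv_O (ul ur : state R) : ~ valveA a M (ul, ur) ->
  RSv a M ul ur = RSp a ul ur.
Proof. by move=> O; apply/funext => xi; rewrite /RSv asboolF. Qed.

(** The ray 0 decides: there [RSv] is the state at rest [ucheck], so agreement with [RSp] brings the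
    middle state to rest. Conversely, a middle state at rest is both [uhat] and [ucheck], and the
    two solvers have the same formula. *)
Lemma valveANP (ul ur : state R) : Omega ul -> Omega ur ->
  valveAN a M (ul, ur) <-> checkc ur = hatc ul.
Proof.
move=> l0 r0; split=> [[A /(_ 0)]|e].
  rewrite RSv_A//= ltxx.
  have := wave2_start (Omega_mkst _ _) r0 (link2_check ur).
  rewrite velocity_mkst => -> e; apply/utilde_at_rest => //; apply: RSp0_at_rest => //.
  by rewrite -e velocity_mkst.
have A : valveA a M (ul, ur) by apply/valveAP => //; rewrite e far_irr.
split=> // xi; rewrite RSv_A//= /RSp e.
have e' : lrho (utilde a ul ur) = hatc ul.
  by have [_ lt _] := utildeP l0 r0; apply/(link1_eq0 lt)/utilde_at_rest.
have -> : utilde a ul ur = mkst (hatc ul) 0.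
  have [t0 _ _] := utildeP l0 r0.
  apply: state_eq => //; rewrite ?lrho_mkst// ?velocity_mkst//.
    exact: Omega_mkst.
  by apply/utilde_at_rest.
by rewrite velocity_mkst.
Qed.

Lemma RSp_RSv_AIc (ul ur : state R) : Omega ul -> Omega ur ->
  (forall xi, RSv a M ul ur xi = RSp a ul ur xi) -> valveAIc a M (ul, ur).
Proof. by move=> l0 r0 e; split=> // -[A]; apply; split. Qed.

Lemma RSv_AIc (ul ur : state R) xi : valveAIc a M (ul, ur) ->
  RSv a M ul ur xi = RSp a ul ur xi.
Proof.
move=> [[l0 r0] nAI]; have [A|O] := pselect (valveA a M (ul, ur)); last first.
  by rewrite RSv_O.
by have [[_ ->//]|nAN] := pselect (valveAN a M (ul, ur)); case: nAI.
Qed.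

Lemma valveAIcP (ul ur : state R) : Omega ul -> Omega ur ->
  valveAIc a M (ul, ur) <-> apart (checkc ur) (hatc ul).
Proof.
move=> l0 r0; split=> [[_ nAI]|].
  have [f|f] := boolP (far (checkc ur) (hatc ul)); first by right.
  left; apply/(valveANP l0 r0); apply: contrapT => nAN; apply: nAI; split=> //.
  by apply/valveAP => //; exact/negbTE.
case=> [/(valveANP l0 r0) N|/(valveOP l0 r0)[_ O]]; split=> //.
  by move=> [_]; apply.
by move=> [/O].
Qed.

Lemma uhat_Omega (u : state R) : Omega u -> Omega (uhat a u).
Proof. by move=> u0; rewrite uhatE//; exact: Omega_mkst. Qed.

Lemma ucheck_Omega (u : state R) : Omega u -> Omega (ucheck a u).
Proof. by move=> u0; rewrite ucheckE//; exact: Omega_mkst. Qed.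

Lemma RSv_Omega (ul ur : state R) xi :
  Omega ul -> Omega ur -> Omega (RSv a M ul ur xi).
Proof.
move=> l0 r0; rewrite /RSv; case: ifP => _; last exact: RSp_Omega.
by case: ifP => _; apply: RSp_Omega => //; [exact: uhat_Omega|exact: ucheck_Omega].
Qed.

Lemma RSv_A_left (ul ur : state R) xi : valveA a M (ul, ur) -> xi < 0 ->
  RSv a M ul ur xi = RSp a ul (uhat a ul) xi.
Proof. by move=> A xi0; rewrite /RSv asboolT// xi0. Qed.

Lemma RSv_A_right (ul ur : state R) xi : valveA a M (ul, ur) -> 0 <= xi ->
  RSv a M ul ur xi = RSp a (ucheck a ur) ur xi.
Proof. by move=> A xi0; rewrite /RSv asboolT// ltNge xi0. Qed.

(** Every state of the 1-wave from [u] to [uhat] is linked to that same state at rest. Replacing the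
    left datum by it keeps the valve closed and [uhat] unchanged. *)
Lemma RSp_hat_hat (u : state R) xi : Omega u -> xi < 0 ->
  hatc (RSp a u (uhat a u) xi) = hatc u.
Proof.
move=> u0 xi0; rewrite uhatE// RSp_hat//.
have [w0 _ wh] := wave1_link u0 (Omega_mkst _ _) xi (link1_hat u).
by rewrite -(proj1 (link1_eq0 wh)) ?velocity_mkst// lrho_mkst.
Qed.

Lemma RSp_check_check (u : state R) xi : Omega u -> 0 <= xi ->
  checkc (RSp a (ucheck a u) u xi) = checkc u.
Proof.
move=> u0 xi0; rewrite ucheckE// RSp_check//.
have [w0 wh _] := wave2_link (Omega_mkst _ _) u0 xi (link2_check u).
by rewrite -(proj1 (link2_eq0 wh)) ?velocity_mkst// lrho_mkst.
Qed.

(** * Consistence as agreement with [RSp], and its form for a closed valve *)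

Lemma consistent_CN (ul ur : state R) : Omega ul -> Omega ur ->
  consistent a M ul ur -> CN1 a M (ul, ur) \/ CN2 a M (ul, ur).
Proof.
move=> l0 r0 cons.
have [[A N]|nAI] := pselect (valveAI a M (ul, ur)).
  left; split=> // xim xip /andP[xim0 xip0] /=.
  split; apply: RSp_RSv_AIc => //; try exact: RSv_Omega.
  (* Left of the closed valve, [RSv] is the Lax solution with right datum [uhat]; its truncation
     prescribed by (cn.1) is therefore [RSp] of the truncated pair. *)
  - move=> xi; have [-> _ _] := cons xim.
    rewrite (RSv_A_left A xim0) RSp_trunc_right//; last exact: uhat_Omega.
    by case: ltP => // h; rewrite (RSv_A_left A)// (lt_trans h).
  - move=> xi; have [_ -> _] := cons xip.
    rewrite (RSv_A_right A xip0) RSp_trunc_left//; last exact: ucheck_Omega.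
    by case: ltP => // h; rewrite (RSv_A_right A)// (le_trans xip0).
have Ic : valveAIc a M (ul, ur) by [].
right; split=> [|xio]; first exact: Ic.
split; apply: RSp_RSv_AIc => //; try exact: RSv_Omega.
  by move=> xi; have [-> _ _] := cons xio; rewrite !RSv_AIc// RSp_trunc_right.
by move=> xi; have [_ -> _] := cons xio; rewrite !RSv_AIc// RSp_trunc_left.
Qed.

(** (cn.2) is (cn.1) read backwards on each side of [xio], so only the two truncations remain. *)
Lemma consistent_trunc (ul ur : state R) :
  (forall xio, (forall xi, RSv a M ul (RSv a M ul ur xio) xi =
      if xi < xio then RSv a M ul ur xi else RSv a M ul ur xio) /\
    (forall xi, RSv a M (RSv a M ul ur xio) ur xi =
      if xi < xio then RSv a M ul ur xio else RSv a M ul ur xi)) ->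
  consistent a M ul ur.
Proof.
move=> tr uv xio; have [tl trr] := tr xio; split; [exact: tl|exact: trr|move=> xi].
by rewrite /uv tl trr; case: (xi < xio).
Qed.

Lemma CN1_consistent (ul ur : state R) : CN1 a M (ul, ur) -> consistent a M ul ur.
Proof.
move=> [/= [A _] cn]; have [[l0 r0] /= _] := A.
have notfar : far (checkc ur) (hatc ul) = false by exact/valveAP.
apply: consistent_trunc => xio; case: (ltP xio 0) => xio0.
  (* The ray 0 is merely a legal nonnegative partner for [xio]. *)
  have [|Il _] := cn xio 0; first by rewrite xio0 lexx.
  split=> xi.
    rewrite RSv_AIc// (RSv_A_left A xio0) RSp_trunc_right//; last exact: uhat_Omega.
    by case: ltP => // h; rewrite (RSv_A_left A)// (lt_trans h).
  have w0 := RSv_Omega xio l0 r0.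
  (* The pair across the valve keeps its two coordinates, so the valve stays closed: the right half
     is untouched and the left half is a truncation towards the same [uhat]. *)
  have hE : hatc (RSv a M ul ur xio) = hatc ul.
    by rewrite (RSv_A_left A xio0) RSp_hat_hat.
  have A' : valveA a M (RSv a M ul ur xio, ur) by apply/valveAP; rewrite ?hE.
  case: (ltP xi 0) => xi0.
    rewrite (RSv_A_left A' xi0) (RSv_A_left A xi0).
    have -> : uhat a (RSv a M ul ur xio) = uhat a ul by rewrite !uhatE// hE.
    by rewrite (RSv_A_left A xio0) RSp_trunc_left//; exact: uhat_Omega.
  rewrite (RSv_A_right A' xi0) (RSv_A_right A xi0).
  by rewrite ifF//; apply/negbTE; lra.
have [|_ Ir] := cn (-1) xio; first by rewrite xio0 ltrN10.
split=> xi; last first.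
  rewrite RSv_AIc// (RSv_A_right A xio0) RSp_trunc_left//; last exact: ucheck_Omega.
  by case: ltP => // h; rewrite (RSv_A_right A)// (le_trans xio0).
have w0 := RSv_Omega xio l0 r0.
have hE : checkc (RSv a M ul ur xio) = checkc ur.
  by rewrite (RSv_A_right A xio0) RSp_check_check.
have A' : valveA a M (ul, RSv a M ul ur xio) by apply/valveAP; rewrite ?hE.
case: (ltP xi 0) => xi0.
  rewrite (RSv_A_left A' xi0) (RSv_A_left A xi0).
  by rewrite ifT//; lra.
rewrite (RSv_A_right A' xi0) (RSv_A_right A xi0).
have -> : ucheck a (RSv a M ul ur xio) = ucheck a ur by rewrite !ucheckE// hE.
by rewrite (RSv_A_right A xio0) RSp_trunc_right//; exact: ucheck_Omega.
Qed.

Lemma CN2_consistent (ul ur : state R) : CN2 a M (ul, ur) -> consistent a M ul ur.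
Proof.
move=> [/= Ic cn]; have [[l0 r0] /= _] := Ic.
apply: consistent_trunc => xio; have [Il Ir] := cn xio.
split=> xi.
  by rewrite (RSv_AIc _ Il) !(RSv_AIc _ Ic) RSp_trunc_right.
by rewrite (RSv_AIc _ Ir) !(RSv_AIc _ Ic) RSp_trunc_left.
Qed.

Lemma consistence_domainE :
  consistence_domain a M = CN1 a M `|` CN2 a M.
Proof.
apply/seteqP; split=> -[ul ur].
  by move=> [[l0 r0] /= cons]; exact: consistent_CN.
case=> cn; split.
- by have [[[]]] := cn.
- exact: CN1_consistent.
- by have [[]] := cn.
- exact: CN2_consistent.
Qed.

(** For negative velocity the 1-wave to [uhat] would be a fan with velocities rising to 0. Its state
    of velocity - d has [checkc] above [hatc ul] by d + laxV d, positive and at most 2 d, so for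
    small d the valve would be closed and acting. The pair (ul, ul) is read on a ray before the
    whole wave. *)
Lemma closed_left (ul ur : state R) : valveA a M (ul, ur) ->
  (forall xi, xi < 0 -> valveAIc a M (ul, RSv a M ul ur xi)) ->
  0 <= velocity ul /\ valveAIc a M (ul, ul).
Proof.
move=> A Ic; have [[l0 r0] /= _] := A.
have lh := link1_hat ul; have h0 : Omega (mkst (hatc ul) 0) by exact: Omega_mkst.
split.
  rewrite leNgt; apply/negP => v0.
  have [e e0 he] := near_not_far (hatc ul).
  (* The first bound keeps the state inside the fan, the second keeps its coordinate near [hatc ul].
     Its ray is lambda_1, that is - a - d. *)
  have [d /andP[d0 dv] de] : exists2 d, 0 < d <= - velocity ul & 2 * d <= e.
    exists (Num.min (- velocity ul) (e / 2)).
      by rewrite lt_min ge_min lexx oppr_gt0 v0 divr_gt0.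
    by rewrite mulrC -ler_pdivlMr// ge_min lexx orbT.
  pose u := raref1 ul (- d).
  have u0 : Omega u by exact: Omega_mkst.
  have uE : RSv a M ul ur (- a - d) = u.
    have a0 := a_gt0; rewrite (RSv_A _ A) ifT; last by lra.
    rewrite wave1E// lrho_mkst velocity_mkst ifF; last first.
      by rewrite /hatc laxV_npos ?(ltW v0)//; apply/negbTE; lra.
    rewrite clampE ?(ltW v0)// addrAC addNr add0r.
    rewrite ifF; last by apply/negbTE; lra.
    by rewrite ifF//; apply/negbTE; lra.
  have xi0 : - a - d < 0 by have := a_gt0; lra.
  have := Ic _ xi0; rewrite uE => /(valveAIcP l0 u0).
  have hE : hatc ul = lrho ul + velocity ul by rewrite /hatc laxV_npos ?ltW.
  have l1 := laxV_le_id d; have := laxV_le 0 d; rewrite laxV0 (ltW d0) => l2.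
  have -> : checkc u = hatc ul + (d + laxV d).
    by rewrite hE /checkc lrho_raref1 velocity_raref1 opprK; ring.
  case=> [|f]; first lra.
  have /he : `|d + laxV d| <= e by rewrite ger0_norm; lra.
  by rewrite f.
have [x hx] := wave1_before l0 h0 lh.
have x0 : Num.min x 0 - 1 < 0 by rewrite ltrBlDr gt_min add0r ltr01 orbT.
have := Ic _ x0; rewrite (RSv_A _ A) x0 hx; first exact.
by rewrite ltrBlDr gt_min ltrDl ltr01.
Qed.

(** Mirror image: the offending state of velocity d lies on the 2-fan from [ucheck], and its [hatc]
    exceeds [checkc ur] by d + laxV d. *)
Lemma closed_right (ul ur : state R) : valveA a M (ul, ur) ->
  (forall xi, 0 <= xi -> valveAIc a M (RSv a M ul ur xi, ur)) ->
  velocity ur <= 0 /\ valveAIc a M (ur, ur).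
Proof.
move=> A Ic; have [[l0 r0] /= _] := A.
have lh := link2_check ur; have h0 : Omega (mkst (checkc ur) 0) by exact: Omega_mkst.
split.
  rewrite leNgt; apply/negP => v0.
  have [e e0 he] := near_not_far (checkc ur).
  have [d /andP[d0 dv] de] : exists2 d, 0 < d <= velocity ur & 2 * d <= e.
    exists (Num.min (velocity ur) (e / 2)).
      by rewrite lt_min ge_min lexx v0 divr_gt0.
    by rewrite mulrC -ler_pdivlMr// ge_min lexx orbT.
  pose u := raref2 (mkst (checkc ur) 0) d.
  have u0 : Omega u by exact: Omega_mkst.
  have xi0 : 0 <= a + d by have := a_gt0; lra.
  have uE : RSv a M ul ur (a + d) = u.
    rewrite (RSv_A _ A) ltNge xi0 /=.
    rewrite wave2E// lrho_mkst velocity_mkst ifF; last first.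
      by rewrite /checkc laxV_npos; [apply/negbTE|]; lra.
    rewrite clampE ?(ltW v0)// addrAC subrr add0r.
    rewrite ifF; last by apply/negbTE; lra.
    by rewrite ifF//; apply/negbTE; lra.
  have := Ic _ xi0; rewrite uE => /(valveAIcP u0 r0).
  have l1 := laxV_le_id d; have := laxV_le 0 d; rewrite laxV0 (ltW d0) => l2.
  have -> : hatc u = checkc ur + (d + laxV d).
    rewrite /hatc velocity_raref2.
    rewrite lrho_raref2.
    rewrite lrho_mkst.
    rewrite velocity_mkst.
    rewrite subr0.
    by rewrite addrA.
  case=> [|f]; first lra.
  have /he : `|d + laxV d| <= e by rewrite ger0_norm; lra.
  by rewrite far_sym f.
have [x hx] := wave2_after h0 r0 lh.
have x0 : 0 <= Num.max x 0 + 1 by rewrite addr_ge0// le_max lexx orbT.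
have := Ic _ x0; rewrite (RSv_A _ A) ltNge x0 /= hx; first exact.
by rewrite -ltrBlDr lt_max ltrBlDr ltrDl ltr01.
Qed.

(** With nonnegative velocity the 1-wave to [uhat] is a shock, or constant at velocity 0. It takes
    only the values [u] and [uhat], and the pair (u, uhat) has equal coordinates at rest. *)
Lemma closed_left_states (u : state R) xi : Omega u ->
  0 <= velocity u -> valveAIc a M (u, u) ->
  valveAIc a M (u, wave1 a u (mkst (hatc u) 0) xi).
Proof.
move=> u0 v0 Iu; have h0 : Omega (mkst (hatc u) 0) by exact: Omega_mkst.
case: (wave1P u0 h0 xi (link1_hat u)) => [_ _|_ _|_ v _].
- exact: Iu.
- by apply/(valveAIcP u0 h0); left; rewrite checkc_rest.
- rewrite velocity_mkst in v *.
  have -> : velocity u = 0 by apply: le_anti; rewrite v v0.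
  rewrite clamp_id -(_ : velocity u = 0) ?raref1_self//.
  by apply: le_anti; rewrite v v0.
Qed.

Lemma closed_right_states (u : state R) xi : Omega u ->
  velocity u <= 0 -> valveAIc a M (u, u) ->
  valveAIc a M (wave2 a (mkst (checkc u) 0) u xi, u).
Proof.
move=> u0 v0 Iu; have h0 : Omega (mkst (checkc u) 0) by exact: Omega_mkst.
case: (wave2P h0 u0 xi (link2_check u)) => [_ _|_ _|c v _].
- by apply/(valveAIcP h0 u0); left; rewrite hatc_rest.
- exact: Iu.
- have vu : velocity u = 0.
    by apply: le_anti; rewrite v0 -(velocity_mkst (checkc u) 0).
  rewrite velocity_mkst vu clamp_id.
  have -> : raref2 (mkst (checkc u) 0) 0 = u; last exact: Iu.
  apply: state_eq; [exact: Omega_mkst|exact: u0| |by rewrite velocity_raref2].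
  by rewrite lrho_raref2 lrho_mkst velocity_mkst /checkc vu oppr0 laxV0; lra.
Qed.

Lemma CN_closed (ul ur : state R) : valveA a M (ul, ur) ->
  CN1 a M (ul, ur) \/ CN2 a M (ul, ur) <-> CNA a M (ul, ur).
Proof.
move=> A; have [[l0 r0] /= _] := A; split=> [cn|[_ [/= ql qr Il Ir]]].
  have Ic xi : (xi < 0 -> valveAIc a M (ul, RSv a M ul ur xi)) /\
               (0 <= xi -> valveAIc a M (RSv a M ul ur xi, ur)).
    case: cn => -[/= _ cn]; last by have [] := cn xi.
    split=> xi0; first by have [|] := cn xi 0; first by rewrite xi0 lexx.
    by have [|] := cn (-1) xi; first by rewrite xi0 ltrN10.
  have [|vl Il] := closed_left A; first by move=> xi; have [] := Ic xi.
  have [|vr Ir] := closed_right A; first by move=> xi; have [] := Ic xi.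
  split; first exact: A.
  by split; [rewrite -velocity_ge0|rewrite -velocity_le0|exact: Il|exact: Ir].
rewrite -velocity_ge0// in ql; rewrite -velocity_le0// in qr.
have [N|nN] := pselect (valveAN a M (ul, ur)); last first.
  left; split; first by split.
  move=> xim xip /andP[m0 p0] /=; rewrite !(RSv_A _ A) m0 ltNge p0 /=.
  by split; [exact: closed_left_states|exact: closed_right_states].
(* Both waves are attached to the same state at rest, and conservation of [hatc] and [checkc] along
   them gives equal coordinates to the pairs reaching across the valve. *)
have e : checkc ur = hatc ul by apply/(valveANP l0 r0).
have h0 : Omega (mkst (hatc ul) 0) by exact: Omega_mkst.
right; split; first by split=> // -[].
move=> xio /=; rewrite (RSv_A _ A) e; case: ifP => _.
  split; first exact: closed_left_states.
  have [w0 _ wh] := wave1_link l0 h0 xio (link1_hat ul).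
  apply/(valveAIcP w0 r0); left; rewrite e.
  by rewrite -(proj1 (link1_eq0 wh)) ?velocity_mkst// lrho_mkst.
have lc := link2_check ur; rewrite e in lc.
split; last by rewrite -e; exact: closed_right_states.
have [w0 wh _] := wave2_link h0 r0 xio lc.
apply/(valveAIcP l0 w0); left.
by rewrite -(proj1 (link2_eq0 wh)) ?velocity_mkst// lrho_mkst.
Qed.

(** * Consistence for an open valve *)

Lemma far_apart x y : far x y -> apart x y. Proof. by right. Qed.

(* Along a rarefaction on which the velocity does not vanish, the states at
   rest reached through the two Lax curves move monotonically, so that it is
   enough to control the end states. *)
Section Rarefaction.
Variables (c v ct vt V : R).
Hypotheses (raref : ct + vt = c + v) (vV : v <= V) (Vt : V <= vt)
  (sgn : 0 < v \/ vt < 0).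

(** The end nearest to [hatc] decides. For v > 0 each [checkc] on the fan lies below that of the
    left end, itself below [hatc]; for vt < 0 each lies above that of the right end, itself above
    [hatc]. *)
Lemma raref_check_apart : apart (c + laxV (- v)) (c + laxV v) ->
  apart (ct + laxV (- vt)) (c + laxV v) ->
  apart (c + v - V + laxV (- V)) (c + laxV v).
Proof.
move: raref vV Vt => r h1 h2 Il It; apply: far_apart; case: sgn => s.
  have l1 : laxV (- v) = - v by rewrite laxV_npos; lra.
  have l2 : laxV (- V) = - V by rewrite laxV_npos; lra.
  have l3 : 0 < laxV v by rewrite -laxV0 laxV_lt.
  apply: (@far_mono (c + laxV (- v)) (c + laxV v)) => //; try lra.
  by apply: apart_far Il; rewrite lt_eqF//; lra.
have l1 : laxV v = v by rewrite laxV_npos; lra.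
have l2 : laxV (- vt) <= laxV (- V) by rewrite laxV_le; lra.
have l3 : 0 < laxV (- vt) by rewrite -laxV0 laxV_lt; lra.
rewrite far_sym; apply: (@far_mono (c + laxV v) (ct + laxV (- vt))); try lra.
by rewrite far_sym; apply: apart_far It; rewrite gt_eqF//; lra.
Qed.

(** For vt < 0, [hatc] is constant along the fan. For v > 0 it decreases towards the right end, by
    contraction of [laxV], and is still above [k] there, so the right end decides. *)
Lemma raref_hat_apart k : apart k (c + laxV v) -> apart k (ct + laxV vt) ->
  (0 < vt -> k < ct) -> apart k (c + v - V + laxV V).
Proof.
move: raref vV Vt => r h1 h2 Il It kt; case: sgn => s.
  have l1 := laxV_contract h2.
  have l2 : 0 < laxV vt by rewrite -laxV0 laxV_lt; lra.
  have {}kt : k < ct by apply: kt; lra.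
  apply: far_apart; apply: (@far_mono k (ct + laxV vt)) => //; try lra.
  by apply: apart_far It; rewrite lt_eqF//; lra.
move: Il; rewrite !laxV_npos; try lra.
by rewrite subrK.
Qed.

End Rarefaction.

Lemma RSp_middle (ul ur : state R) : Omega ul -> Omega ur ->
  RSp a ul ur (velocity (utilde a ul ur)) = utilde a ul ur.
Proof.
move=> l0 r0; have [t0 _ tr] := utildeP l0 r0.
by rewrite /RSp ltxx wave2_start.
Qed.

Lemma RSp_before (ul ur : state R) : Omega ul -> Omega ur ->
  exists xi, RSp a ul ur xi = ul.
Proof.
move=> l0 r0; have [t0 lt _] := utildeP l0 r0.
have [x hx] := wave1_before l0 t0 lt.
exists (Num.min x (velocity (utilde a ul ur)) - 1).
by rewrite /RSp ifT ?hx// ltrBlDr gt_min ltrDl ltr01 ?orbT.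
Qed.

Lemma RSp_after (ul ur : state R) : Omega ul -> Omega ur ->
  exists xi, RSp a ul ur xi = ur.
Proof.
move=> l0 r0; have [t0 _ tr] := utildeP l0 r0.
have [x hx] := wave2_after t0 r0 tr.
set y := velocity (utilde a ul ur); exists (Num.max x y + 1).
have xm : x <= Num.max x y by rewrite le_max lexx.
have ym : y <= Num.max x y by rewrite le_max lexx orbT.
rewrite /RSp ifF ?hx//; first by rewrite ltr_pwDr.
by apply/negbTE; rewrite -leNgt ler_wpDr.
Qed.

Lemma RSp_raref1 (ul ur : state R) xi (t := utilde a ul ur) :
  Omega ul -> Omega ur -> lrho t <= lrho ul ->
  lambda1 a ul <= xi <= lambda1 a t ->
  RSp a ul ur xi = raref1 ul (xi + a).
Proof.
rewrite /lambda1 => l0 r0 raref /andP[x1 x2]; have [t0 lt tr] := utildeP l0 r0.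
have a0 := a_gt0; rewrite /RSp ifT; last by rewrite -/t; lra.
rewrite wave1E// ltNge raref /= clampE ?link1_le//.
rewrite ifF; last by apply/negbTE; lra.
by rewrite ifF//; apply/negbTE; rewrite -/t; lra.
Qed.

Lemma RSp_raref2 (ul ur : state R) xi (t := utilde a ul ur) :
  Omega ul -> Omega ur -> lrho t <= lrho ur ->
  lambda2 a t <= xi <= lambda2 a ur ->
  RSp a ul ur xi = raref2 t (xi - a).
Proof.
rewrite /lambda2 => l0 r0 raref /andP[x1 x2]; have [t0 lt tr] := utildeP l0 r0.
have a0 := a_gt0; rewrite /RSp ifF; last by apply/negbTE; rewrite -/t; lra.
rewrite wave2E// ltNge raref /= clampE ?link2_le//.
rewrite ifF; last by apply/negbTE; rewrite -/t; lra.
by rewrite ifF//; apply/negbTE; lra.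
Qed.

(** The velocity sweeps the whole interval between the end velocities; it vanishes on the ray - a in
    the first family and a in the second. *)
Lemma q_neq0_along_rarefactionsP (ul ur : state R) (t := utilde a ul ur) :
  Omega ul -> Omega ur ->
  q_neq0_along_rarefactions a ul ur <->
  (lrho t < lrho ul -> 0 < velocity ul \/ velocity t < 0) /\
  (lrho t < lrho ur -> 0 < velocity t \/ velocity ur < 0).
Proof.
move=> l0 r0; have [t0 lt tr] := utildeP l0 r0.
have a0 := a_gt0.
rewrite /q_neq0_along_rarefactions -/t -!lrho_lt//.
split=> -[h1 h2]; split=> c.
- have [vl|vl] := ltP 0 (velocity ul); first by left.
  have [vt|vt] := ltP (velocity t) 0; first by right.
  have xi0 : lambda1 a ul <= - a <= lambda1 a t.
    by rewrite /lambda1; apply/andP; split; lra.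
  have /eqP[] := h1 c (- a) xi0.
  by rewrite (RSp_raref1 l0 r0 (ltW c) xi0) addNr /= mul0r.
- have [vt|vt] := ltP 0 (velocity t); first by left.
  have [vr|vr] := ltP (velocity ur) 0; first by right.
  have xi0 : lambda2 a t <= a <= lambda2 a ur.
    by rewrite /lambda2; apply/andP; split; lra.
  have /eqP[] := h2 c a xi0.
  by rewrite (RSp_raref2 l0 r0 (ltW c) xi0) subrr /= mul0r.
- move=> xi xi0; rewrite (RSp_raref1 l0 r0 (ltW c) xi0).
  rewrite -velocity_eq0; last exact: Omega_mkst.
  move: xi0; rewrite /lambda1 velocity_raref1 => /andP[x1 x2].
  by case: (h1 c) => h; [rewrite gt_eqF|rewrite lt_eqF]; rewrite // -/t; lra.
- move=> xi xi0; rewrite (RSp_raref2 l0 r0 (ltW c) xi0).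
  rewrite -velocity_eq0; last exact: Omega_mkst.
  move: xi0; rewrite /lambda2 velocity_raref2 => /andP[x1 x2].
  by case: (h2 c) => h; [rewrite gt_eqF|rewrite lt_eqF]; rewrite // -/t; lra.
Qed.

(** On a 1-fan meeting velocity 0, a state of small velocity d > 0 has [checkc] equal to hatc ul - 2
    d: distinct, not far. On a 2-fan, velocity - d gives [hatc] equal to checkc ur - 2 d. These
    signs make [laxV] the identity, and the middle velocity, nonzero for an open valve, leaves room
    on that side. *)
Lemma CN2_open_q_neq0 (ul ur : state R) (t := utilde a ul ur) :
  valveO a M (ul, ur) -> CN2 a M (ul, ur) ->
  q_neq0_along_rarefactions a ul ur.
Proof.
move=> O [/= _ cn]; have [[l0 r0] /= _] := O.
have [t0 lt tr] := utildeP l0 r0; rewrite -/t in t0 lt tr.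
have vt0 : velocity t != 0.
  apply/eqP => /(utilde_at_rest l0 r0) e.
  by move/(valveOP l0 r0): O; rewrite e far_irr.
have a0 := a_gt0.
apply/(q_neq0_along_rarefactionsP l0 r0); rewrite -/t; split=> c.
- have [vl|vl] := ltP 0 (velocity ul); first by left.
  have [vt|vt] := ltP (velocity t) 0; first by right.
  have {}vt : 0 < velocity t by rewrite lt_neqAle eq_sym vt0.
  have [e e0 he] := near_not_far (hatc ul).
  have [d /andP[d0 dv] de] : exists2 d, 0 < d <= velocity t & 2 * d <= e.
    exists (Num.min (velocity t) (e / 2)).
      by rewrite lt_min ge_min lexx vt divr_gt0.
    by rewrite mulrC -ler_pdivlMr// ge_min lexx orbT.
  pose u := raref1 ul d; have u0 : Omega u by exact: Omega_mkst.
  have uE : RSp a ul ur (d - a) = u.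
    rewrite (RSp_raref1 l0 r0 (ltW c)) ?subrK//.
    by rewrite /lambda1 -/t; apply/andP; split; lra.
  have [+ _] := cn (d - a); rewrite RSv_O; last by case: O.
  rewrite uE => /(valveAIcP l0 u0).
  have hE : hatc ul = lrho ul + velocity ul by rewrite /hatc laxV_npos.
  have -> : checkc u = hatc ul + (- (2 * d)).
    rewrite hE /checkc lrho_raref1 velocity_raref1 laxV_npos ?oppr_le0 ?ltW//.
    by ring.
  case=> [|f]; first lra.
  have /he : `|- (2 * d)| <= e by rewrite normrN ger0_norm; lra.
  by rewrite f.
- have [vt|vt] := ltP 0 (velocity t); first by left.
  have [vr|vr] := ltP (velocity ur) 0; first by right.
  have {}vt : velocity t < 0 by rewrite lt_neqAle vt0.
  have [e e0 he] := near_not_far (checkc ur).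
  have [d /andP[d0 dv] de] : exists2 d, 0 < d <= - velocity t & 2 * d <= e.
    exists (Num.min (- velocity t) (e / 2)).
      by rewrite lt_min ge_min lexx oppr_gt0 vt divr_gt0.
    by rewrite mulrC -ler_pdivlMr// ge_min lexx orbT.
  pose u := raref2 t (- d); have u0 : Omega u by exact: Omega_mkst.
  have uE : RSp a ul ur (a - d) = u.
    rewrite (RSp_raref2 l0 r0 (ltW c)); first by rewrite addrAC subrr add0r.
    by rewrite /lambda2 -/t; apply/andP; split; lra.
  have [_] := cn (a - d); rewrite RSv_O; last by case: O.
  rewrite uE => /(valveAIcP u0 r0).
  have rc : lrho t - velocity t = lrho ur - velocity ur.
    by rewrite tr lax_npos; lra.
  have hE : checkc ur = lrho ur - velocity ur by rewrite /checkc laxV_npos; lra.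
  have -> : hatc u = checkc ur + (- (2 * d)).
    rewrite hE /hatc lrho_raref2 velocity_raref2 laxV_npos ?oppr_le0 ?ltW//.
    by rewrite rc; ring.
  case=> [|f]; first lra.
  have /he : `|- (2 * d)| <= e by rewrite normrN ger0_norm; lra.
  by rewrite far_sym f.
Qed.

Lemma CN_open (ul ur : state R) (t := utilde a ul ur) : valveO a M (ul, ur) ->
  CN2 a M (ul, ur) <-> CNO a M (ul, ur).
Proof.
move=> O; have [[l0 r0] /= nA] := O; have [t0 lt tr] := utildeP l0 r0.
rewrite -/t in t0 lt tr.
have lr : apart (checkc ur) (hatc ul) by right; apply/(valveOP l0 r0).
split=> [cn|[_ [/= Il Ir Ilt Itr qn]]].
  have qn := CN2_open_q_neq0 O cn; have [/= _ {}cn] := cn.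
  have I xi : valveAIc a M (ul, RSp a ul ur xi) /\
              valveAIc a M (RSp a ul ur xi, ur).
    by have := cn xi; rewrite RSv_O.
  (* Cuts before all waves, at the middle ray and after all waves give the four required pairs. *)
  have [xl hl] := RSp_before l0 r0; have [xr hr] := RSp_after l0 r0.
  have ht := RSp_middle l0 r0.
  have [Ilt Itr] := I (velocity t); rewrite ht in Ilt Itr.
  have [Il _] := I xl; rewrite hl in Il.
  have [_ Ir] := I xr; rewrite hr in Ir.
  exact: (conj O (And5 Il Ir Ilt Itr qn)).
have lt' : 0 < velocity t -> checkc ur < lrho t by rewrite (link2_gt0 tr).
have tr' : velocity t < 0 -> lrho t < checkc ur by rewrite (link2_lt0 tr).
have tl1 : velocity t < 0 -> hatc ul < lrho t by rewrite (link1_lt0 lt).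
have vt0 : velocity t != 0.
  apply/eqP => /(utilde_at_rest l0 r0) e.
  by move/(valveOP l0 r0): O; rewrite e far_irr.
have vt : 0 < velocity t \/ velocity t < 0.
  by move: vt0; rewrite neq_lt => /orP[]; [right|left].
have [sl sr] := proj1 (q_neq0_along_rarefactionsP l0 r0) qn.
rewrite -/t in sl sr.
have Icl : valveAIc a M (ul, ur) by apply/(valveAIcP l0 r0).
split; first exact: Icl.
move=> xio /=; rewrite RSv_O; last exact: nA.
have w0 := RSp_Omega xio l0 r0; move: w0; rewrite /RSp -/t; case: ifP => _.
  case: (wave1P l0 t0 xio lt) => [_ _ _|_ _ _|c v cv w0];
    [exact: (conj Il Icl)|exact: (conj Ilt Itr)|].
  have /andP[V1 V2] := clamp_bounds (xio + a) v.
  (* A wave without density decrease is constant here, and inherits the nonzero sign of the middle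
     velocity. *)
  have {}sl : 0 < velocity ul \/ velocity t < 0.
    have [/sl//|ct] := ltP (lrho t) (lrho ul).
    have ve : velocity t = velocity ul by lra.
    by rewrite -ve; exact: vt.
  move/(valveAIcP l0 l0) in Il; move/(valveAIcP l0 t0) in Ilt.
  move/(valveAIcP t0 r0) in Itr.
  split.
    apply/(valveAIcP l0 w0); rewrite /checkc lrho_raref1 velocity_raref1.
    exact: (raref_check_apart cv V1 V2 sl Il Ilt).
  apply/(valveAIcP w0 r0); rewrite /hatc lrho_raref1 velocity_raref1.
  exact: (raref_hat_apart cv V1 V2 sl lr Itr lt').
case: (wave2P t0 r0 xio tr) => [_ _ _|_ _ _|c v cv w0];
  [exact: (conj Ilt Itr)|exact: (conj Icl Ir)|].
have /andP[V1 V2] := clamp_bounds (xio - a) v.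
set V := clamp _ _ _ in V1 V2 w0 *.
(* Changing the sign of velocities turns the 2-fan from [t] to [ur] into a 1-fan from [ur] to [t]
   and exchanges [hatc] with [checkc], so the lemmas on 1-fans apply. *)
have {}sr : 0 < - velocity ur \/ - velocity t < 0.
  have [/sr[]|ct] := ltP (lrho t) (lrho ur); [by right; lra|by left; lra|].
  have vE : velocity t = velocity ur by lra.
  by case: vt => h; [right|left]; lra.
have apart_sym x y : apart x y -> apart y x by case; [left|right; rewrite far_sym].
move/(valveAIcP r0 r0)/apart_sym in Ir; move/(valveAIcP l0 t0)/apart_sym in Ilt.
move/(valveAIcP t0 r0)/apart_sym in Itr; move/apart_sym in lr.
have cv' : lrho t - velocity t = lrho ur - velocity ur by lra.
have V1' : - velocity ur <= - V by lra.
have V2' : - V <= - velocity t by lra.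
have wE : lrho t - velocity t + V = lrho ur + - velocity ur - - V by lra.
split.
  apply/(valveAIcP l0 w0); rewrite /checkc lrho_raref2 velocity_raref2 wE.
  apply: apart_sym; apply: (raref_hat_apart cv' V1' V2' sr lr Ilt).
  by move=> h; apply: tl1; lra.
apply/(valveAIcP w0 r0); rewrite /hatc lrho_raref2 velocity_raref2 wE.
apply: apart_sym; rewrite -{2}(opprK V).
apply: (raref_check_apart cv' V1' V2' sr); rewrite opprK//.
Qed.

Lemma CN_domainE : CN1 a M `|` CN2 a M = CNO a M `|` CNA a M.
Proof.
apply/seteqP; split=> -[ul ur].
  move=> cn; have [A|nA] := pselect (valveA a M (ul, ur)).
    by right; apply/CN_closed.
  have O : valveO a M (ul, ur).
    by split; last exact: nA; case: cn => -[] [].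
  by case: cn => [[[]]//|cn]; left; apply/CN_open.
case=> cn; first by right; apply/CN_open => //; case: cn.
by apply/CN_closed => //; case: cn.
Qed.

(** * The invariant domain *)

Lemma winv_zinvE (u : state R) : Omega u ->
  winv a u = (velocity u + lrho u) / a /\ zinv a u = (velocity u - lrho u) / a.
Proof.
move=> u0; rewrite /winv /zinv /lrho /velocity.
by split; field; rewrite a_neq0 gt_eqF.
Qed.

(** With [u0] at rest the domain is the wedge c + |v| <= c0 with apex [u0]. *)
Lemma Idom_restP (u0 u : state R) : Omega u0 -> u0.2 = 0 ->
  Idom a u0 u <-> [/\ Omega u, velocity u + lrho u <= lrho u0 &
    lrho u - velocity u <= lrho u0].
Proof.
move=> o0 q0; have v0 : velocity u0 = 0 by rewrite /velocity q0 mul0r.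
have [w0E z0E] := winv_zinvE o0.
suff e : Omega u -> zinv a u0 <= zinv a u /\ winv a u <= winv a u0 <->
    velocity u + lrho u <= lrho u0 /\ lrho u - velocity u <= lrho u0.
  by split=> -[uo h1 h2]; have [] := e uo; split=> //; tauto.
move=> uo; have [wE zE] := winv_zinvE uo.
by rewrite wE zE w0E z0E v0 !ler_pM2r ?invr_gt0//; split=> -[h1 h2]; split; lra.
Qed.

Lemma invariant_Idom (u0 : state R) : Omega u0 -> u0.2 = 0 ->
  invariant_domain a M (Idom a u0).
Proof.
move=> o0 q0; split=> [u []//|ul ur].
pose I u := [/\ Omega u, velocity u + lrho u <= lrho u0 &
    lrho u - velocity u <= lrho u0].
have II u : Idom a u0 u <-> I u by exact: Idom_restP.
have IRSp u w xi : I u -> I w -> I (RSp a u w xi).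
  move=> Iu Iw; have [uo u1 u2] := Iu; have [wo w1 w2] := Iw.
  have [to ut tw] := utildeP uo wo; set t := utilde a u w in to ut tw *.
  have It : I t.
    (* These bound c + v at the middle state by its value at the left datum, and c - v by its value
       at the right one. *)
    have g1 := lax_ge (lrho t - lrho u); have g2 := lax_ge (lrho t - lrho w).
    by split=> //; [rewrite ut|rewrite tw]; lra.
  have [_ t1 t2] := It.
  rewrite /RSp -/t; case: ifP => _.
    case: (wave1P uo to xi ut) => // c v cv.
    have /andP[V1 V2] := clamp_bounds (xi + a) v.
    split; [exact: Omega_mkst| |]; rewrite lrho_raref1 velocity_raref1; lra.
  case: (wave2P to wo xi tw) => // c v cv.
  have /andP[V1 V2] := clamp_bounds (xi - a) v.
  split; [exact: Omega_mkst| |]; rewrite lrho_raref2 velocity_raref2; lra.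
move=> /II Il /II Ir _ [xi _ <-]; apply/II.
have [lo l1 l2] := Il; have [ro r1 r2] := Ir.
rewrite /RSv; case: ifP => _; last exact: IRSp.
have hl := laxV_le_id (velocity ul); have hr := laxV_le_id (- velocity ur).
case: ifP => _; apply: IRSp => //.
  rewrite uhatE//; split; [exact: Omega_mkst| |];
    by rewrite lrho_mkst velocity_mkst /hatc; lra.
rewrite ucheckE//; split; [exact: Omega_mkst| |];
  by rewrite lrho_mkst velocity_mkst /checkc; lra.
Qed.

(** * One-sided limits, traces and coherence *)

Lemma cvg_mkst (T : Type) (F : set_system T) {FF : Filter F} (c v : T -> R)
    (c0 v0 : R) : c t @[t --> F] --> c0 -> v t @[t --> F] --> v0 ->
  mkst (c t) (v t) @[t --> F] --> mkst c0 v0.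
Proof.
move=> cc vv.
have e : expR (c t / a) @[t --> F] --> expR (c0 / a).
  apply: continuous_cvg; first exact: continuous_expR.
  by apply: cvgM; [exact: cc|exact: cvg_cst].
exact: (cvg_pair e (cvgM vv e)).
Qed.

Lemma cvg_clamp (T : Type) (F : set_system T) {FF : Filter F} (x y t : T -> R)
    (x0 y0 t0 : R) : x s @[s --> F] --> x0 -> y s @[s --> F] --> y0 ->
  t s @[s --> F] --> t0 -> clamp (x s) (y s) (t s) @[s --> F] --> clamp x0 y0 t0.
Proof.
move=> xx yy tt; rewrite /clamp maxr_absE minr_absE.
under eq_fun do rewrite maxr_absE minr_absE.
have m : (y s + t s - `|y s - t s|) / 2 @[s --> F] --> (y0 + t0 - `|y0 - t0|) / 2.
  apply: cvgM; last exact: cvg_cst.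
  by apply: cvgB; [exact: cvgD|apply: cvg_norm; exact: cvgB].
apply: cvgM; last exact: cvg_cst.
by apply: cvgD; [exact: cvgD|apply: cvg_norm; exact: cvgB].
Qed.

Lemma trace_limE (F : set_system R) {FF : ProperFilter F} (f : R -> state R) u :
  f xi @[xi --> F] --> u ->
  (lim ((f xi).1 @[xi --> F]), lim ((f xi).2 @[xi --> F])) = u.
Proof.
move=> fu; rewrite [RHS]surjective_pairing; congr pair; apply/cvg_lim => //.
  by apply: (cvg_comp _ _ fu); exact: cvg_fst.
by apply: (cvg_comp _ _ fu); exact: cvg_snd.
Qed.

(** The left limit can differ from the value only at a shock. The second alternative then also
    records that the wave is constant before the jump, which determines the Riemann problem of the
    traces. *)
Lemma wave1_left_cvg (um up : state R) x : Omega um -> Omega up ->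
  link1 um up ->
  wave1 a um up xi @[xi --> x^'-] --> wave1 a um up x \/
  wave1 a um up xi @[xi --> x^'-] --> um /\
    forall xi, xi < x -> wave1 a um up xi = um.
Proof.
move=> m0 p0 mp; have [shock|raref] := ltP (lrho um) (lrho up).
  under eq_fun do rewrite wave1E// shock.
  rewrite wave1E// shock.
  set s := velocity um - _; have [xs|sx] := leP x s.
    have lt_s xi : xi < x -> (if xi < s then um else up) = um.
      by move=> h; rewrite (lt_le_trans h).
    right; split=> //; last first.
      by move=> xi h; rewrite wave1E// shock lt_s.
    apply: cvg_near_cst; near=> xi; apply: lt_s; near: xi.
    exact: nbhs_left_lt.
  left; apply: cvg_near_cst; near=> xi; rewrite [x < s]ltNge (ltW sx) /=.
  by rewrite ltNge ltW//; near: xi; exact: nbhs_left_gt.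
left; under eq_fun do rewrite wave1E// ltNge raref /=.
rewrite wave1E// ltNge raref /=; apply: cvg_at_left_filter.
apply: cvg_mkst.
  apply: cvgB; first exact: cvg_cst.
  by apply: cvg_clamp; [exact: cvg_cst|exact: cvg_cst|];
    apply: cvgD; [exact: cvg_id|exact: cvg_cst].
by apply: cvg_clamp; [exact: cvg_cst|exact: cvg_cst|];
  apply: cvgD; [exact: cvg_id|exact: cvg_cst].
Unshelve. all: by end_near. Qed.

Lemma wave1_right_cvg (um up : state R) x : Omega um -> Omega up ->
  link1 um up -> wave1 a um up xi @[xi --> x^'+] --> wave1 a um up x.
Proof.
move=> m0 p0 mp; have [shock|raref] := ltP (lrho um) (lrho up).
  under eq_fun do rewrite wave1E// shock.
  rewrite wave1E// shock.
  set s := velocity um - _; have [xs|sx] := ltP x s.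
    apply: cvg_near_cst; near=> xi; rewrite ifT//.
  apply: cvg_near_cst; near=> xi; rewrite ifF//; apply/negbTE; rewrite -leNgt.
  by apply: (le_trans sx); near: xi; exact: nbhs_right_ge.
under eq_fun do rewrite wave1E// ltNge raref /=.
rewrite wave1E// ltNge raref /=; apply: cvg_at_right_filter; apply: cvg_mkst.
  apply: cvgB; first exact: cvg_cst.
  by apply: cvg_clamp; [exact: cvg_cst|exact: cvg_cst|];
    apply: cvgD; [exact: cvg_id|exact: cvg_cst].
by apply: cvg_clamp; [exact: cvg_cst|exact: cvg_cst|];
  apply: cvgD; [exact: cvg_id|exact: cvg_cst].
Unshelve. all: by end_near. Qed.

Lemma wave2_right_cvg (um up : state R) x : Omega um -> Omega up ->
  link2 um up -> wave2 a um up xi @[xi --> x^'+] --> wave2 a um up x.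
Proof.
move=> m0 p0 mp; have [shock|raref] := ltP (lrho up) (lrho um).
  under eq_fun do rewrite wave2E// shock.
  rewrite wave2E// shock.
  set s := velocity up + _; have [xs|sx] := ltP x s.
    apply: cvg_near_cst; near=> xi; rewrite ifT//.
  apply: cvg_near_cst; near=> xi; rewrite ifF//; apply/negbTE; rewrite -leNgt.
  by apply: (le_trans sx); near: xi; exact: nbhs_right_ge.
under eq_fun do rewrite wave2E// ltNge raref /=.
rewrite wave2E// ltNge raref /=; apply: cvg_at_right_filter; apply: cvg_mkst.
  apply: cvgD; first exact: cvg_cst.
  by apply: cvg_clamp; [exact: cvg_cst|exact: cvg_cst|];
    apply: cvgB; [exact: cvg_id|exact: cvg_cst].
by apply: cvg_clamp; [exact: cvg_cst|exact: cvg_cst|];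
  apply: cvgB; [exact: cvg_id|exact: cvg_cst].
Unshelve. all: by end_near. Qed.

Lemma wave2_left_cvg (um up : state R) x : Omega um -> Omega up ->
  link2 um up ->
  wave2 a um up xi @[xi --> x^'-] --> wave2 a um up x \/
  wave2 a um up xi @[xi --> x^'-] --> um /\
    forall xi, xi < x -> wave2 a um up xi = um.
Proof.
move=> m0 p0 mp; have [shock|raref] := ltP (lrho up) (lrho um).
  under eq_fun do rewrite wave2E// shock.
  rewrite wave2E// shock.
  set s := velocity up + _; have [xs|sx] := leP x s.
    have lt_s xi : xi < x -> (if xi < s then um else up) = um.
      by move=> h; rewrite (lt_le_trans h).
    right; split=> //; last first.
      by move=> xi h; rewrite wave2E// shock lt_s.
    apply: cvg_near_cst; near=> xi; apply: lt_s; near: xi.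
    exact: nbhs_left_lt.
  left; apply: cvg_near_cst; near=> xi; rewrite [x < s]ltNge (ltW sx) /=.
  by rewrite ltNge ltW//; near: xi; exact: nbhs_left_gt.
left; under eq_fun do rewrite wave2E// ltNge raref /=.
rewrite wave2E// ltNge raref /=; apply: cvg_at_left_filter; apply: cvg_mkst.
  apply: cvgD; first exact: cvg_cst.
  by apply: cvg_clamp; [exact: cvg_cst|exact: cvg_cst|];
    apply: cvgB; [exact: cvg_id|exact: cvg_cst].
by apply: cvg_clamp; [exact: cvg_cst|exact: cvg_cst|];
  apply: cvgB; [exact: cvg_id|exact: cvg_cst].
Unshelve. all: by end_near. Qed.

Lemma RSp_const (u : state R) xi : Omega u -> RSp a u u xi = u.
Proof.
move=> u0; rewrite /RSp (utilde_uniq u0 u0 u0 (link1_refl _) (link2_refl _)).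
by rewrite wave1_const wave2_const; case: ifP.
Qed.

Lemma RSp_right_cvg (ul ur : state R) x : Omega ul -> Omega ur ->
  RSp a ul ur xi @[xi --> x^'+] --> RSp a ul ur x.
Proof.
move=> l0 r0; have [t0 lt tr] := utildeP l0 r0; rewrite {2}/RSp.
case: ltP => h.
  apply: cvg_trans (wave1_right_cvg (x := x) l0 t0 lt); apply: near_eq_cvg.
  near=> xi; rewrite /RSp ifT//; near: xi; exact: nbhs_right_lt.
apply: cvg_trans (wave2_right_cvg (x := x) t0 r0 tr); apply: near_eq_cvg.
near=> xi; rewrite /RSp ifF//; apply/negbTE; rewrite -leNgt.
by apply: (le_trans h); apply: ltW; near: xi; exact: nbhs_right_gt.
Unshelve. all: by end_near. Qed.

(** The traces at a ray are separated by at most one jump: without a jump the problem is constant,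
    at a 1-shock the left trace is [ul], at a 2-shock it is the middle state, and truncation solves
    the problem. *)
Lemma RSp_left_cvg (ul ur : state R) x : Omega ul -> Omega ur ->
  exists um, [/\ RSp a ul ur xi @[xi --> x^'-] --> um, Omega um &
    forall xi, RSp a um (RSp a ul ur x) xi =
      if xi < x then um else RSp a ul ur x].
Proof.
move=> l0 r0; have [t0 lt tr] := utildeP l0 r0.
set t := utilde a ul ur in t0 lt tr *.
have w0 := RSp_Omega x l0 r0.
have const : RSp a ul ur xi @[xi --> x^'-] --> RSp a ul ur x ->
    exists um, [/\ RSp a ul ur xi @[xi --> x^'-] --> um, Omega um &
    forall xi, RSp a um (RSp a ul ur x) xi =
      if xi < x then um else RSp a ul ur x].
  move=> c; exists (RSp a ul ur x); split; [exact: c|exact: w0|move=> xi].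
  by rewrite RSp_const//; case: (xi < x).
case: (ltgtP x (velocity t)) => h.
- have near1 : {near x^'-, wave1 a ul t =1 RSp a ul ur}.
    near=> xi; rewrite /RSp ifT//; apply: lt_trans h; near: xi.
    exact: nbhs_left_lt.
  have xE : RSp a ul ur x = wave1 a ul t x by rewrite /RSp h.
  case: (wave1_left_cvg x l0 t0 lt) => [c|[c e]].
    by apply: const; rewrite xE; apply: cvg_trans c; exact: near_eq_cvg.
  exists ul; split; [by apply: cvg_trans c; exact: near_eq_cvg|exact: l0|].
  move=> xi; rewrite RSp_trunc_right//; case: ltP => // hx.
  by rewrite /RSp ifT ?e// (lt_trans hx h).
- have near2 : {near x^'-, wave2 a t ur =1 RSp a ul ur}.
    near=> xi; rewrite /RSp ifF//; apply/negbTE; rewrite -leNgt ltW//.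
  have xE : RSp a ul ur x = wave2 a t ur x by rewrite /RSp ltNge (ltW h).
  case: (wave2_left_cvg x t0 r0 tr) => [c|[c e]].
    by apply: const; rewrite xE; apply: cvg_trans c; exact: near_eq_cvg.
  (* The pair of traces arises from the data by two cuts, at the middle ray and at [x]. *)
  exists t; split; [by apply: cvg_trans c; exact: near_eq_cvg|exact: t0|].
  have tE : RSp a ul ur (velocity t) = t by exact: RSp_middle.
  have xtE : RSp a t ur x = RSp a ul ur x.
    by rewrite -{1}tE RSp_trunc_left// ltNge (ltW h).
  move=> xi; have := RSp_trunc_right x xi t0 r0; rewrite xtE => ->.
  case: ltP => hx; last exact: erefl.
  have := RSp_trunc_left (velocity t) xi l0 r0; rewrite tE => ->.
  case: ltP => ht; first by [].
  by rewrite /RSp ltNge ht /= e.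
- apply: const; rewrite h RSp_middle//; apply: cvg_near_cst.
  have [y yt hy] := wave1_end l0 t0 lt.
  near=> xi; rewrite /RSp ifT; last by near: xi; exact: nbhs_left_lt.
  by apply: hy; near: xi; exact: nbhs_left_gt.
Unshelve. all: by end_near. Qed.

(** The inner states have velocity 0, so the left wave ends at a negative ray and the right one
    begins at a positive ray. *)
Lemma RSv_A_traces (ul ur : state R) : valveA a M (ul, ur) ->
  trace_left (RSv a M ul ur) = mkst (hatc ul) 0 /\
  trace_right (RSv a M ul ur) = mkst (checkc ur) 0.
Proof.
move=> A; have [[l0 r0] /= _] := A.
have h0 : Omega (mkst (hatc ul) 0) by exact: Omega_mkst.
have c0 : Omega (mkst (checkc ur) 0) by exact: Omega_mkst.
have [x + hx] := wave1_end l0 h0 (link1_hat ul).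
have [y + hy] := wave2_begin c0 r0 (link2_check ur).
rewrite !velocity_mkst => y0 x0.
split; apply: trace_limE; apply: cvg_near_cst; near=> xi; rewrite (RSv_A _ A).
  rewrite ifT; last by near: xi; exact: nbhs_left_lt.
  by apply: hx; near: xi; exact: nbhs_left_gt.
rewrite ifF; last by apply/negbTE; rewrite -leNgt; near: xi; exact: nbhs_right_ge.
by apply: hy; near: xi; exact: nbhs_right_lt.
Unshelve. all: by end_near. Qed.

Lemma coherence_domainE : coherence_domain a M = CH a M.
Proof.
apply/seteqP; split=> -[ul ur].
  move=> [[/= l0 r0]]; have [A|nA] := pselect (valveA a M (ul, ur)); first by left.
  rewrite /coherent /= (RSv_O nA); have [um [ml m0 _]] := RSp_left_cvg 0 l0 r0.
  have rE : trace_right (RSp a ul ur) = RSp a ul ur 0.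
    by apply: trace_limE; exact: RSp_right_cvg.
  have lE : trace_left (RSp a ul ur) = um by exact: trace_limE.
  rewrite rE lE => coh; right.
  have w0 := RSp_Omega 0 l0 r0.
  split; first by split.
  rewrite /= rE lE; split; first by split.
  (* A valve closed on the traces takes a value at rest on the ray 0. Coherence equates it with
     [RSp] there, so the middle state is at rest and the original pair would be in [valveA]. *)
  move=> A; have := coh 0; rewrite (RSv_A _ A) ltxx.
  have := wave2_start (Omega_mkst _ _) w0 (link2_check (RSp a ul ur 0)).
  rewrite velocity_mkst => -> e; apply: nA.
  apply/(valveAP l0 r0); rewrite (proj1 (utilde_at_rest l0 r0)) ?far_irr//.
  by apply: RSp0_at_rest => //; rewrite -e velocity_mkst.
case=> [A|[/= nA AA]].
  have [[l0 r0] /= _] := A; split; first by [].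
  have h0 : Omega (mkst (hatc ul) 0) by exact: Omega_mkst.
  have c0 : Omega (mkst (checkc ur) 0) by exact: Omega_mkst.
  rewrite /coherent /=; have [-> ->] := RSv_A_traces A.
  have A' : valveA a M (mkst (hatc ul) 0, mkst (checkc ur) 0).
    by apply/(valveAP h0 c0); rewrite hatc_rest checkc_rest; exact/valveAP.
  move=> xi; rewrite (RSv_A _ A') hatc_rest checkc_rest.
  by rewrite wave1_const wave2_const.
have [[/= l0 r0] nA'] := nA; split; first by [].
move: AA; rewrite /coherent /= (RSv_O nA').
have [um [ml m0 coh]] := RSp_left_cvg 0 l0 r0.
have -> : trace_right (RSp a ul ur) = RSp a ul ur 0.
  by apply: trace_limE; exact: RSp_right_cvg.
have -> : trace_left (RSp a ul ur) = um by exact: trace_limE.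
by move=> [_ nB]; rewrite (RSv_O nB).
Qed.

(** * Continuous dependence of the middle state and of the waves *)

Lemma wave1_between (um up : state R) xi : Omega um -> Omega up ->
  link1 um up ->
  `|lrho (wave1 a um up xi) - lrho um| <= `|lrho up - lrho um| /\
  `|velocity (wave1 a um up xi) - velocity um| <= `|velocity up - velocity um|.
Proof.
move=> m0 p0 mp; have abs0 (x : R) : `|x - x| = 0 by rewrite subrr normr0.
case: (wave1P m0 p0 xi mp) => [_ _|_ _|c v cv].
- by rewrite !abs0 !normr_ge0.
- by rewrite !lexx.
have /andP[V1 V2] := clamp_bounds (xi + a) v.
rewrite lrho_raref1 velocity_raref1; split.
  by rewrite !ler0_norm; lra.
by rewrite !ger0_norm; lra.
Qed.

Lemma wave2_between (um up : state R) xi : Omega um -> Omega up ->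
  link2 um up ->
  `|lrho (wave2 a um up xi) - lrho um| <= `|lrho up - lrho um| /\
  `|velocity (wave2 a um up xi) - velocity um| <= `|velocity up - velocity um|.
Proof.
move=> m0 p0 mp; have abs0 (x : R) : `|x - x| = 0 by rewrite subrr normr0.
case: (wave2P m0 p0 xi mp) => [_ _|_ _|c v cv].
- by rewrite !abs0 !normr_ge0.
- by rewrite !lexx.
have /andP[V1 V2] := clamp_bounds (xi - a) v.
rewrite lrho_raref2 velocity_raref2; split.
  by rewrite !ger0_norm; lra.
by rewrite !ger0_norm; lra.
Qed.

Section Convergence.
Variables (T : Type) (F : set_system T).
Hypothesis FF : Filter F.

(** Convergence is taken in the coordinates (c, v), in which the links and the waves are written; on
    [Omega] it is interchangeable with convergence of pairs. *)
Definition cvg_state (f : T -> state R) (u : state R) : Prop :=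
  lrho (f t) @[t --> F] --> lrho u /\ velocity (f t) @[t --> F] --> velocity u.

Lemma cvg_state_cvg f u : (forall t, Omega (f t)) -> Omega u ->
  cvg_state f u -> f t @[t --> F] --> u.
Proof.
move=> f0 u0 [fl fv]; rewrite -[X in _ --> X](mkst_lrho u0).
have -> : f = fun t => mkst (lrho (f t)) (velocity (f t)).
  by apply/funext => t; rewrite mkst_lrho.
exact: cvg_mkst fl fv.
Qed.

Lemma cvg_cvg_state f u : Omega u -> f t @[t --> F] --> u -> cvg_state f u.
Proof.
move=> u0 fu.
have f1 : (f t).1 @[t --> F] --> u.1 by apply: (cvg_comp _ _ fu); exact: cvg_fst.
have f2 : (f t).2 @[t --> F] --> u.2 by apply: (cvg_comp _ _ fu); exact: cvg_snd.
split.
  apply: cvgM; first exact: cvg_cst.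
  by apply: continuous_cvg => //; exact: continuous_ln.
by apply: cvgM => //; apply: cvgV => //; rewrite gt_eqF.
Qed.

Lemma cvg_mkst_state (c v : T -> R) (c0 v0 : R) :
  c t @[t --> F] --> c0 -> v t @[t --> F] --> v0 ->
  cvg_state (fun t => mkst (c t) (v t)) (mkst c0 v0).
Proof.
move=> cc vv; split; rewrite ?lrho_mkst ?velocity_mkst;
  by [under eq_fun do rewrite lrho_mkst|under eq_fun do rewrite velocity_mkst].
Qed.

Lemma cvg_near_eq_state f g u : (\forall t \near F, f t = g t) ->
  cvg_state f u -> cvg_state g u.
Proof.
move=> fg [fl fv]; split.
  by apply: cvg_trans fl; apply: near_eq_cvg; apply: filterS fg => t ->.
by apply: cvg_trans fv; apply: near_eq_cvg; apply: filterS fg => t ->.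
Qed.

Lemma laxV_dist y z : `|laxV y - laxV z| <= `|y - z|.
Proof.
wlog yz : y z / z <= y => [h|].
  have [/h//|/ltW/h] := leP z y.
  by rewrite distrC [`|z - y|]distrC.
by have := laxV_contract yz; rewrite !ger0_norm ?subr_ge0// laxV_le.
Qed.

Lemma laxV_continuous : continuous laxV.
Proof.
move=> y; apply/cvgrPdist_le => e e0; near=> z.
apply: le_trans (laxV_dist _ _) _; near: z.
by apply: cvgr_dist_le => //; exact: cvg_id.
Unshelve. all: by end_near. Qed.

Lemma cvg_hatc f u : cvg_state f u -> hatc (f t) @[t --> F] --> hatc u.
Proof.
move=> [fl fv]; apply: cvgD => //.
by apply: continuous_cvg fv; exact: laxV_continuous.
Qed.

Lemma cvg_checkc f u : cvg_state f u -> checkc (f t) @[t --> F] --> checkc u.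
Proof.
move=> [fl fv]; apply: cvgD => //.
by apply: continuous_cvg; [exact: laxV_continuous|exact: cvgN].
Qed.

(** Were the new middle coordinate larger by more than the bound, both arguments of [lax] would
    increase, and by expansion their sum would grow more than the velocities allow. Exchanging the
    data gives the other direction. *)
Lemma utilde_lrho_le (ul ur ul' ur' : state R) :
  Omega ul -> Omega ur -> Omega ul' -> Omega ur' ->
  lrho (utilde a ul' ur') - lrho (utilde a ul ur) <=
  `|lrho ul - lrho ul'| + `|velocity ul - velocity ul'| +
  (`|lrho ur - lrho ur'| + `|velocity ur - velocity ur'|).
Proof.
move=> l0 r0 l0' r0'; have [t0 lt tr] := utildeP l0 r0.
have [t0' lt' tr'] := utildeP l0' r0'.
move: lt tr lt' tr'; rewrite /link1 /link2.
set c := lrho (utilde a ul ur); set c' := lrho (utilde a ul' ur').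
move=> -> e -> e'; rewrite leNgt; apply/negP => h.
have abs (x y : R) : - `|x - y| <= x - y <= `|x - y| by rewrite -ler_norml.
have /andP[a1 a2] := abs (lrho ul) (lrho ul').
have /andP[b1 b2] := abs (velocity ul) (velocity ul').
have /andP[c1 c2] := abs (lrho ur) (lrho ur').
have /andP[d1 d2] := abs (velocity ur) (velocity ur').
have := normr_ge0 (lrho ul - lrho ul'); have := normr_ge0 (lrho ur - lrho ur').
have := normr_ge0 (velocity ul - velocity ul').
have := normr_ge0 (velocity ur - velocity ur') => n1 n2 n3 n4.
have /lax_expand : c - lrho ul <= c' - lrho ul' by lra.
have /lax_expand : c - lrho ur <= c' - lrho ur' by lra.
lra.
Qed.

Lemma cvg_utilde ul_ ur_ ul ur :
  (forall t, Omega (ul_ t)) -> (forall t, Omega (ur_ t)) -> Omega ul -> Omega ur ->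
  cvg_state ul_ ul -> cvg_state ur_ ur ->
  cvg_state (fun t => utilde a (ul_ t) (ur_ t)) (utilde a ul ur).
Proof.
move=> l0_ r0_ l0 r0 [ll lv] [rl rv]; pose t_ s := utilde a (ul_ s) (ur_ s).
have tl : lrho (t_ s) @[s --> F] --> lrho (utilde a ul ur).
  pose d s := `|lrho ul - lrho (ul_ s)| + `|velocity ul - velocity (ul_ s)| +
    (`|lrho ur - lrho (ur_ s)| + `|velocity ur - velocity (ur_ s)|).
  have cd : d s @[s --> F] --> (0 : R).
    have z (g : T -> R) x : g s @[s --> F] --> x -> `|x - g s| @[s --> F] --> (0 : R).
      move=> gx; rewrite -(@normr0 _ R) -(subrr x); apply: cvg_norm.
      by apply: cvgB => //; exact: cvg_cst.
    rewrite -[X in _ --> X](addr0 0) -[X in X + _](addr0 0) -[X in _ + X](addr0 0).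
    by apply: cvgD; apply: cvgD; exact: z.
  apply: (@squeeze_cvgr _ _ _ _ (fun s => lrho (utilde a ul ur) - d s)
    (fun s => lrho (utilde a ul ur) + d s)).
  - near=> s.
    have h1 := utilde_lrho_le l0 r0 (l0_ s) (r0_ s).
    have h2 := utilde_lrho_le (l0_ s) (r0_ s) l0 r0.
    rewrite (distrC (lrho (ul_ s))) (distrC (lrho (ur_ s))) in h2.
    rewrite (distrC (velocity (ul_ s))) (distrC (velocity (ur_ s))) in h2.
    by rewrite -/(d s) -/(t_ s) in h1 h2 *; lra.
  - by rewrite -[X in _ --> X]subr0; apply: cvgB; [exact: cvg_cst|].
  - by rewrite -[X in _ --> X]addr0; apply: cvgD; [exact: cvg_cst|].
split=> //; have [_ -> _] := utildeP l0 r0.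
have -> : (fun s => velocity (utilde a (ul_ s) (ur_ s))) =
    fun s => velocity (ul_ s) - lax (lrho (t_ s) - lrho (ul_ s)).
  by apply/funext => s; have [_ -> _] := utildeP (l0_ s) (r0_ s).
apply: cvgB => //; apply: continuous_cvg; first exact: lax_continuous.
exact: cvgB.
Unshelve. all: by end_near. Qed.

Section Waves.
Variables (um_ up_ : T -> state R) (um up : state R) (xi : R).
Hypotheses (m0_ : forall t, Omega (um_ t)) (p0_ : forall t, Omega (up_ t))
  (m0 : Omega um) (p0 : Omega up) (cm : cvg_state um_ um) (cp : cvg_state up_ up).

(** When the limit wave is constant, the approximating waves may be shocks or fans; in either case
    their amplitude tends to 0 and squeezes the values. *)
Lemma cvg_state_between (w_ : T -> state R) :
  (forall t, `|lrho (w_ t) - lrho (um_ t)| <= `|lrho (up_ t) - lrho (um_ t)| /\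
   `|velocity (w_ t) - velocity (um_ t)| <=
     `|velocity (up_ t) - velocity (um_ t)|) ->
  um = up -> cvg_state w_ um.
Proof.
move=> h e; move: cp; rewrite -e => -[pl pv]; have [ml mv] := cm.
have sq (w m p : T -> R) (x : R) : m t @[t --> F] --> x -> p t @[t --> F] --> x ->
    (forall t, `|w t - m t| <= `|p t - m t|) -> w t @[t --> F] --> x.
  move=> mx px wmp.
  have d0 : `|p t - m t| @[t --> F] --> (0 : R).
    by rewrite -(@normr0 _ R) -(subrr x); apply: cvg_norm; exact: cvgB.
  apply: (@squeeze_cvgr _ _ _ _ (fun t => m t - `|p t - m t|)
    (fun t => m t + `|p t - m t|)).
  - by near=> t; have := wmp t; rewrite ler_norml; lra.
  - by rewrite -[X in _ --> X]subr0; apply: cvgB.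
  - by rewrite -[X in _ --> X]addr0; apply: cvgD.
by split; [apply: (sq _ _ _ _ ml pl)|apply: (sq _ _ _ _ mv pv)] => t; have [] := h t.
Unshelve. all: by end_near. Qed.

(** A strict order of the limit coordinates persists and fixes the type of wave, and off the shock
    speed the side of the shock is fixed too. Equal coordinates mean a constant limit, left to the
    amplitude bound. *)
Lemma cvg_state_wave1 : (forall t, link1 (um_ t) (up_ t)) -> link1 um up ->
  xi != velocity um - shock_gap (lrho up - lrho um) ->
  cvg_state (fun t => wave1 a (um_ t) (up_ t) xi) (wave1 a um up xi).
Proof.
move=> mp_ mp xis; have [ml mv] := cm; have [pl pv] := cp.
case: (ltgtP (lrho um) (lrho up)) => [shock|raref|eq_mp].
- have near_shock : \forall t \near F, lrho (um_ t) < lrho (up_ t).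
    have : \forall t \near F, 0 < lrho (up_ t) - lrho (um_ t).
      by apply: (cvgr_gt _ (cvgB pl ml)); rewrite subr_gt0.
    by apply: filterS => t; rewrite subr_gt0.
  have cs : velocity (um_ t) - shock_gap (lrho (up_ t) - lrho (um_ t)) @[t --> F]
      --> velocity um - shock_gap (lrho up - lrho um).
    apply: cvgB => //; apply: continuous_cvg; first exact: shock_gap_continuous.
    exact: cvgB.
  rewrite wave1E// shock; move: xis; rewrite neq_lt => /orP[h|h].
    have hn := cvgr_gt _ cs _ h.
    rewrite h; apply: cvg_near_eq_state cm; near=> t.
    rewrite wave1E// ifT; last by near: t; exact: near_shock.
    by rewrite ifT//; near: t; exact: hn.
  have hn := cvgr_lt _ cs _ h.
  rewrite ifF; last by apply/negbTE; rewrite -leNgt ltW.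
  apply: cvg_near_eq_state cp; near=> t.
  rewrite wave1E// ifT; last by near: t; exact: near_shock.
  by rewrite ifF//; apply/negbTE; rewrite -leNgt ltW//; near: t; exact: hn.
- have near_raref : \forall t \near F, lrho (up_ t) < lrho (um_ t).
    have : \forall t \near F, 0 < lrho (um_ t) - lrho (up_ t).
      by apply: (cvgr_gt _ (cvgB ml pl)); rewrite subr_gt0.
    by apply: filterS => t; rewrite subr_gt0.
  rewrite wave1E// ltNge (ltW raref) /=.
  apply: (@cvg_near_eq_state (fun t => raref1 (um_ t)
    (clamp (velocity (um_ t)) (velocity (up_ t)) (xi + a)))).
    near=> t; rewrite wave1E// ltNge ltW//; near: t; exact: near_raref.
  have cc : clamp (velocity (um_ t)) (velocity (up_ t)) (xi + a) @[t --> F] -->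
      clamp (velocity um) (velocity up) (xi + a).
    by apply: cvg_clamp => //; exact: cvg_cst.
  by apply: cvg_mkst_state => //; apply: cvgB => //; exact: cvgD.
- have e : um = up.
    by apply: state_eq => //; rewrite mp eq_mp subrr lax0 subr0.
  rewrite -e wave1_const; apply: cvg_state_between => // t.
  exact: wave1_between.
Unshelve. all: by end_near. Qed.

Lemma cvg_state_wave2 : (forall t, link2 (um_ t) (up_ t)) -> link2 um up ->
  xi != velocity up + shock_gap (lrho um - lrho up) ->
  cvg_state (fun t => wave2 a (um_ t) (up_ t) xi) (wave2 a um up xi).
Proof.
move=> mp_ mp xis; have [ml mv] := cm; have [pl pv] := cp.
case: (ltgtP (lrho up) (lrho um)) => [shock|raref|eq_mp].
- have near_shock : \forall t \near F, lrho (up_ t) < lrho (um_ t).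
    have : \forall t \near F, 0 < lrho (um_ t) - lrho (up_ t).
      by apply: (cvgr_gt _ (cvgB ml pl)); rewrite subr_gt0.
    by apply: filterS => t; rewrite subr_gt0.
  have cs : velocity (up_ t) + shock_gap (lrho (um_ t) - lrho (up_ t)) @[t --> F]
      --> velocity up + shock_gap (lrho um - lrho up).
    apply: cvgD => //; apply: continuous_cvg; first exact: shock_gap_continuous.
    exact: cvgB.
  rewrite wave2E// shock; move: xis; rewrite neq_lt => /orP[h|h].
    have hn := cvgr_gt _ cs _ h.
    rewrite h; apply: cvg_near_eq_state cm; near=> t.
    rewrite wave2E// ifT; last by near: t; exact: near_shock.
    by rewrite ifT//; near: t; exact: hn.
  have hn := cvgr_lt _ cs _ h.
  rewrite ifF; last by apply/negbTE; rewrite -leNgt ltW.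
  apply: cvg_near_eq_state cp; near=> t.
  rewrite wave2E// ifT; last by near: t; exact: near_shock.
  by rewrite ifF//; apply/negbTE; rewrite -leNgt ltW//; near: t; exact: hn.
- have near_raref : \forall t \near F, lrho (um_ t) < lrho (up_ t).
    have : \forall t \near F, 0 < lrho (up_ t) - lrho (um_ t).
      by apply: (cvgr_gt _ (cvgB pl ml)); rewrite subr_gt0.
    by apply: filterS => t; rewrite subr_gt0.
  rewrite wave2E// ltNge (ltW raref) /=.
  apply: (@cvg_near_eq_state (fun t => raref2 (um_ t)
    (clamp (velocity (um_ t)) (velocity (up_ t)) (xi - a)))).
    near=> t; rewrite wave2E// ltNge ltW//; near: t; exact: near_raref.
  have cc : clamp (velocity (um_ t)) (velocity (up_ t)) (xi - a) @[t --> F] -->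
      clamp (velocity um) (velocity up) (xi - a).
    by apply: cvg_clamp => //; exact: cvg_cst.
  by apply: cvg_mkst_state => //; apply: cvgD => //; exact: cvgB.
- have e : um = up.
    by apply: state_eq => //; rewrite mp eq_mp subrr lax0 addr0.
  rewrite -e wave2_const; apply: cvg_state_between => // t.
  exact: wave2_between.
Unshelve. all: by end_near. Qed.

End Waves.
End Convergence.

(** * Measurability, uniform bounds and pointwise limits *)

Definition meas_state (f : R -> state R) : Prop :=
  measurable_fun setT (fun xi => (f xi).1) /\
  measurable_fun setT (fun xi => (f xi).2).

(** These are the hypotheses of dominated convergence on bounded intervals, where a constant is
    integrable. A finite list of exceptional rays makes gluing a matter of concatenation. *)
Definition dominated_cvg (f_ : nat -> R -> state R) (f : R -> state R) : Prop :=
  [/\ forall n, meas_state (f_ n), meas_state f,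
      exists K, forall n xi, `|(f_ n xi).1| <= K /\ `|(f_ n xi).2| <= K
    & exists s : seq R, forall xi, xi \notin s ->
        f_ n xi @[n --> \oo] --> f xi].

Lemma meas_state_glue (y : R) f g : meas_state f -> meas_state g ->
  meas_state (fun xi => if xi < y then f xi else g xi).
Proof.
move=> [f1 f2] [g1 g2].
have my : measurable_fun setT (fun xi : R => xi < y).
  by apply: measurable_fun_ltr; [exact: measurable_id|exact: measurable_cst].
split.
  under eq_fun do rewrite (fun_if fst).
  exact: measurable_fun_ifT.
under eq_fun do rewrite (fun_if snd).
exact: measurable_fun_ifT.
Qed.

Lemma meas_state_cst u : meas_state (fun=> u).
Proof. by split; exact: measurable_cst. Qed.

Lemma meas_state_mkst (c v : R -> R) : continuous c -> continuous v ->
  meas_state (fun xi => mkst (c xi) (v xi)).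
Proof.
move=> cc cv.
have ce : continuous (fun xi => expR (c xi / a)).
  move=> xi; apply: continuous_cvg; first exact: continuous_expR.
  by apply: cvgM; [exact: cc|exact: cvg_cst].
split; apply: continuous_measurable_fun => // xi.
by apply: cvgM; [exact: cv|exact: ce].
Qed.

Lemma meas_state_wave1 (um up : state R) : Omega um -> Omega up ->
  link1 um up -> meas_state (wave1 a um up).
Proof.
move=> m0 p0 mp; have -> : wave1 a um up = if lrho um < lrho up then
    fun xi => if xi < velocity um - shock_gap (lrho up - lrho um) then um else up
  else fun xi => raref1 um (clamp (velocity um) (velocity up) (xi + a)).
  by apply/funext => xi; rewrite wave1E//; case: ifP.
case: ifP => _; first by apply: meas_state_glue; exact: meas_state_cst.
have cc : continuous (fun xi => clamp (velocity um) (velocity up) (xi + a)).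
  move=> xi; apply: cvg_clamp; [exact: cvg_cst|exact: cvg_cst|].
  by apply: cvgD; [exact: cvg_id|exact: cvg_cst].
apply: meas_state_mkst => // xi.
by apply: cvgB; [exact: cvg_cst|exact: cc].
Qed.

Lemma meas_state_wave2 (um up : state R) : Omega um -> Omega up ->
  link2 um up -> meas_state (wave2 a um up).
Proof.
move=> m0 p0 mp; have -> : wave2 a um up = if lrho up < lrho um then
    fun xi => if xi < velocity up + shock_gap (lrho um - lrho up) then um else up
  else fun xi => raref2 um (clamp (velocity um) (velocity up) (xi - a)).
  by apply/funext => xi; rewrite wave2E//; case: ifP.
case: ifP => _; first by apply: meas_state_glue; exact: meas_state_cst.
have cc : continuous (fun xi => clamp (velocity um) (velocity up) (xi - a)).
  move=> xi; apply: cvg_clamp; [exact: cvg_cst|exact: cvg_cst|].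
  by apply: cvgB; [exact: cvg_id|exact: cvg_cst].
apply: meas_state_mkst => // xi.
by apply: cvgD; [exact: cvg_cst|exact: cc].
Qed.

Lemma cvg_bounded (u_ : nat -> R) (l : R) : u_ n @[n --> \oo] --> l ->
  exists K, forall n, `|u_ n| <= K.
Proof.
move=> ul; have /cvg_seq_bounded[K [_ HK]] : cvgn u_ by apply/cvg_ex; exists l.
by exists (K + 1) => n; apply: HK => //; rewrite ltrDl.
Qed.

Lemma between_bounded (um_ up_ : nat -> state R) (um up : state R)
    (w_ : nat -> R -> state R) :
  cvg_state \oo um_ um -> cvg_state \oo up_ up ->
  (forall n xi, Omega (w_ n xi)) ->
  (forall n xi,
    `|lrho (w_ n xi) - lrho (um_ n)| <= `|lrho (up_ n) - lrho (um_ n)| /\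
    `|velocity (w_ n xi) - velocity (um_ n)| <=
      `|velocity (up_ n) - velocity (um_ n)|) ->
  exists K, forall n xi, `|(w_ n xi).1| <= K /\ `|(w_ n xi).2| <= K.
Proof.
move=> [/cvg_bounded[K1 k1] /cvg_bounded[K2 k2]].
move=> [/cvg_bounded[K3 k3] /cvg_bounded[K4 k4]] w0 btw.
(* From |w| <= |w - m| + |m| <= |p - m| + |m| <= 2 |m| + |p|. *)
pose L := 2 * K1 + K3; pose V := 2 * K2 + K4.
have tri (x y z k l : R) : `|x - y| <= `|z - y| -> `|y| <= k -> `|z| <= l ->
    `|x| <= 2 * k + l.
  move=> h yk zl; have := ler_normD (x - y) y; rewrite subrK.
  by have := ler_normB z y; lra.
have lL n xi : lrho (w_ n xi) <= L.
  by apply: le_trans (ler_norm _) _; apply: (tri _ _ _ _ _ (proj1 (btw n xi))).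
have vV n xi : `|velocity (w_ n xi)| <= V.
  exact: (tri _ _ _ _ _ (proj2 (btw n xi))).
exists (Num.max (expR (L / a)) (V * expR (L / a))) => n xi.
have w1 : `|(w_ n xi).1| <= expR (L / a).
  rewrite -(mkst_lrho (w0 n xi)) /= gtr0_norm ?expR_gt0// ler_expR.
  by rewrite ler_pM2r ?invr_gt0.
split; rewrite le_max ?w1// momentumE// normrM ler_pM ?orbT//.
Qed.

Lemma dominated_cvg_wave1 (um_ up_ : nat -> state R) (um up : state R) :
  (forall n, Omega (um_ n)) -> (forall n, Omega (up_ n)) -> Omega um -> Omega up ->
  cvg_state \oo um_ um -> cvg_state \oo up_ up ->
  (forall n, link1 (um_ n) (up_ n)) -> link1 um up ->
  dominated_cvg (fun n => wave1 a (um_ n) (up_ n)) (wave1 a um up).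
Proof.
move=> m0_ p0_ m0 p0 cm cp mp_ mp; split.
- by move=> n; exact: meas_state_wave1.
- exact: meas_state_wave1.
- apply: (between_bounded cm cp) => n xi; last exact: wave1_between.
  by have [] := wave1_link (m0_ n) (p0_ n) xi (mp_ n).
- exists [:: velocity um - shock_gap (lrho up - lrho um)] => xi.
  rewrite inE => h; apply: cvg_state_cvg.
  + by move=> n; have [] := wave1_link (m0_ n) (p0_ n) xi (mp_ n).
  + by have [] := wave1_link m0 p0 xi mp.
  + exact: cvg_state_wave1.
Qed.

Lemma dominated_cvg_wave2 (um_ up_ : nat -> state R) (um up : state R) :
  (forall n, Omega (um_ n)) -> (forall n, Omega (up_ n)) -> Omega um -> Omega up ->
  cvg_state \oo um_ um -> cvg_state \oo up_ up ->
  (forall n, link2 (um_ n) (up_ n)) -> link2 um up ->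
  dominated_cvg (fun n => wave2 a (um_ n) (up_ n)) (wave2 a um up).
Proof.
move=> m0_ p0_ m0 p0 cm cp mp_ mp; split.
- by move=> n; exact: meas_state_wave2.
- exact: meas_state_wave2.
- apply: (between_bounded cm cp) => n xi; last exact: wave2_between.
  by have [] := wave2_link (m0_ n) (p0_ n) xi (mp_ n).
- exists [:: velocity up + shock_gap (lrho um - lrho up)] => xi.
  rewrite inE => h; apply: cvg_state_cvg.
  + by move=> n; have [] := wave2_link (m0_ n) (p0_ n) xi (mp_ n).
  + by have [] := wave2_link m0 p0 xi mp.
  + exact: cvg_state_wave2.
Qed.

(** Away from the limit [y] of the moving rays the choice of branch is eventually constant, so [y]
    is the one new exceptional ray. *)
Lemma dominated_cvg_glue (y_ : nat -> R) (y : R) f_ f g_ g :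
  y_ n @[n --> \oo] --> y -> dominated_cvg f_ f -> dominated_cvg g_ g ->
  dominated_cvg (fun n xi => if xi < y_ n then f_ n xi else g_ n xi)
    (fun xi => if xi < y then f xi else g xi).
Proof.
move=> yy [mf_ mf [K hK] [s hs]] [mg_ mg [L hL] [r hr]]; split.
- by move=> n; exact: meas_state_glue.
- exact: meas_state_glue.
- exists (Num.max K L) => n xi; rewrite !le_max.
  by case: ifP => _; [have [-> ->] := hK n xi|have [-> ->] := hL n xi];
    rewrite ?orbT.
- exists (y :: s ++ r) => xi; rewrite inE mem_cat !negb_or => /and3P[xy xs xr].
  move: xy; rewrite neq_lt => /orP[h|h].
    rewrite h; apply: cvg_trans (hs xi xs); apply: near_eq_cvg.
    have hn := cvgr_gt _ yy _ h; near=> n.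
    by rewrite ifT//; near: n; exact: hn.
  rewrite ltNge (ltW h) /=; apply: cvg_trans (hr xi xr); apply: near_eq_cvg.
  have hn := cvgr_lt _ yy _ h; near=> n.
  by rewrite ltNge ltW//; near: n; exact: hn.
Unshelve. all: by end_near. Qed.

Lemma dominated_cvg_RSp (ul_ ur_ : nat -> state R) (ul ur : state R) :
  (forall n, Omega (ul_ n)) -> (forall n, Omega (ur_ n)) -> Omega ul -> Omega ur ->
  cvg_state \oo ul_ ul -> cvg_state \oo ur_ ur ->
  dominated_cvg (fun n => RSp a (ul_ n) (ur_ n)) (RSp a ul ur).
Proof.
move=> l0_ r0_ l0 r0 cl cr; have [t0 lt tr] := utildeP l0 r0.
have ct : cvg_state \oo (fun n => utilde a (ul_ n) (ur_ n)) (utilde a ul ur).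
  exact: cvg_utilde.
have t_ n := utildeP (l0_ n) (r0_ n).
have t0_ n : Omega (utilde a (ul_ n) (ur_ n)) by have [] := t_ n.
have [_ cv] := ct.
apply: (dominated_cvg_glue cv).
  by apply: (dominated_cvg_wave1 l0_ t0_ l0 t0 cl ct) => // n; have [] := t_ n.
by apply: (dominated_cvg_wave2 t0_ r0_ t0 r0 ct cr) => // n; have [] := t_ n.
Qed.

Lemma dominated_cvg_closed (ul_ ur_ : nat -> state R) (ul ur : state R) :
  (forall n, Omega (ul_ n)) -> (forall n, Omega (ur_ n)) -> Omega ul -> Omega ur ->
  cvg_state \oo ul_ ul -> cvg_state \oo ur_ ur ->
  (forall n, valveA a M (ul_ n, ur_ n)) -> valveA a M (ul, ur) ->
  dominated_cvg (fun n => RSv a M (ul_ n) (ur_ n)) (RSv a M ul ur).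
Proof.
move=> l0_ r0_ l0 r0 cl cr A_ A.
have -> : (fun n => RSv a M (ul_ n) (ur_ n)) = fun n xi =>
    if xi < 0 then wave1 a (ul_ n) (mkst (hatc (ul_ n)) 0) xi
    else wave2 a (mkst (checkc (ur_ n)) 0) (ur_ n) xi.
  by apply/funext => n; apply/funext => xi; rewrite (RSv_A _ (A_ n)).
have -> : RSv a M ul ur = fun xi =>
    if xi < 0 then wave1 a ul (mkst (hatc ul) 0) xi
    else wave2 a (mkst (checkc ur) 0) ur xi.
  by apply/funext => xi; rewrite (RSv_A _ A).
apply: (@dominated_cvg_glue (fun=> 0) 0); first exact: cvg_cst.
  have h0_ n : Omega (mkst (hatc (ul_ n)) 0) by exact: Omega_mkst.
  have ch : cvg_state \oo (fun n => mkst (hatc (ul_ n)) 0) (mkst (hatc ul) 0).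
    by apply: cvg_mkst_state; [exact: cvg_hatc|exact: cvg_cst].
  apply: (dominated_cvg_wave1 l0_ h0_ l0 (Omega_mkst _ _) cl ch).
    by move=> n; exact: link1_hat.
  exact: link1_hat.
have c0_ n : Omega (mkst (checkc (ur_ n)) 0) by exact: Omega_mkst.
have cc : cvg_state \oo (fun n => mkst (checkc (ur_ n)) 0) (mkst (checkc ur) 0).
  by apply: cvg_mkst_state; [exact: cvg_checkc|exact: cvg_cst].
apply: (dominated_cvg_wave2 c0_ r0_ (Omega_mkst _ _) r0 cc cr).
  by move=> n; exact: link2_check.
exact: link2_check.
Qed.

(** * Convergence of the integrals and the continuity domain *)

Lemma enorm_le (u : state R) : enorm u <= `|u.1| + `|u.2|.
Proof.
rewrite /enorm -(ger0_norm (addr_ge0 (normr_ge0 u.1) (normr_ge0 u.2))) -sqrtr_sqr.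
rewrite ler_wsqrtr// sqrrD !real_normK ?num_real// lerD2r lerDl.
by rewrite mulrn_wge0// mulr_ge0.
Qed.

Lemma enorm_ge2 (u : state R) : `|u.2| <= enorm u.
Proof. by rewrite /enorm -sqrtr_sqr ler_wsqrtr// lerDr sqr_ge0. Qed.

Lemma enorm_cvg (u_ : nat -> state R) (u w : state R) :
  u_ n @[n --> \oo] --> u -> enorm (u_ n - w) @[n --> \oo] --> enorm (u - w).
Proof.
move=> uu.
have c1 : (u_ n).1 @[n --> \oo] --> u.1 by apply: (cvg_comp _ _ uu); exact: cvg_fst.
have c2 : (u_ n).2 @[n --> \oo] --> u.2 by apply: (cvg_comp _ _ uu); exact: cvg_snd.
have sq (f : nat -> R) (x y : R) : f n @[n --> \oo] --> x ->
    (f n - y) ^+ 2 @[n --> \oo] --> (x - y) ^+ 2.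
  move=> fx; have fxy : f n - y @[n --> \oo] --> x - y.
    by apply: cvgB => //; exact: cvg_cst.
  exact: (cvgM fxy fxy).
exact: (cvg_comp _ _ (cvgD (sq _ _ _ c1) (sq _ _ _ c2)) (@sqrt_continuous R _)).
Qed.

Lemma measurable_enormB (f g : R -> state R) : meas_state f -> meas_state g ->
  measurable_fun setT (fun xi => enorm (f xi - g xi)).
Proof.
move=> [f1 f2] [g1 g2].
apply: (measurableT_comp (continuous_measurable_fun (@sqrt_continuous R))).
by apply: measurable_funD; apply: measurable_funX; exact: measurable_funB.
Qed.

(** The reference [g] may differ from the limit [f]. At the threshold, [f] is [RSp] and [g] is
    [RSv], and the limit is their distance. *)
Lemma dominated_cvg_L1 f_ f g (x1 x2 : R) :
  dominated_cvg f_ f -> dominated_cvg (fun=> g) g ->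
  (\int[@lebesgue_measure R]_(xi in `[x1, x2]) (enorm (f_ n xi - g xi))%:E)%E
    @[n --> \oo] -->
  (\int[@lebesgue_measure R]_(xi in `[x1, x2]) (enorm (f xi - g xi))%:E)%E.
Proof.
move=> [mf_ mf [K hK] [s hs]] [_ mg [L hL] _].
have mD : measurable (`[x1, x2]%classic : set R) by exact: measurable_itv.
pose B := K + L + (K + L).
have le_B n xi : enorm (f_ n xi - g xi) <= B.
  apply: le_trans (enorm_le _) _.
  have [k1 k2] := hK n xi; have [l1 l2] := hL 0 xi.
  by apply: lerD; apply: le_trans (ler_normB _ _) _; exact: lerD.
have [||||| _ _ h] := @dominated_convergence _ _ _ (@lebesgue_measure R) _ mD
  (fun n xi => (enorm (f_ n xi - g xi))%:E) (fun xi => (enorm (f xi - g xi))%:E)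
  (fun=> B%:E).
- move=> n; apply/measurable_EFinP; apply: measurable_funTS.
  exact: measurable_enormB.
- by apply/measurable_EFinP; apply: measurable_funTS; exact: measurable_enormB.
- exists [set` s]; split.
  + by apply: countable_measurable => //; apply: finite_set_countable; exact: finite_seq.
  + by apply: countable_lebesgue_measure0; apply: finite_set_countable; exact: finite_seq.
  + move=> xi /=; apply: contra_notP => /negP xis _.
    apply: cvg_EFin; first by near=> n.
    by apply: enorm_cvg; exact: hs.
- apply: measurable_bounded_integrable => //.
    by rewrite /= lebesgue_measure_itv/=; case: ifP => _; rewrite ?ltry// -EFinD ltry.
  by exists `|B|; split; [exact: num_real|move=> y yB x _; exact: ltW].
- apply: aeW => xi n _; rewrite /= ger0_norm ?sqrtr_ge0// lee_fin.
  exact: le_B.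
exact: h.
Unshelve. all: by end_near. Qed.

(** Dominated convergence concerns sequences. Balls of radius 1 / (n + 1) form a base at [x], so a
    failure along the filter is witnessed by a sequence, on which the property [P], valid near [x],
    can be imposed; here [P] fixes the state of the valve. *)
Lemma cvg_within_seq (T : pseudoMetricType R) (U : topologicalType)
    (D P : set T) (G : T -> U) (x : T) (l : U) :
  (\forall y \near within D (nbhs x), P y) ->
  (forall y_ : nat -> T, (forall n, D (y_ n)) -> (forall n, P (y_ n)) ->
    y_ n @[n --> \oo] --> x -> G (y_ n) @[n --> \oo] --> l) ->
  G y @[y --> within D (nbhs x)] --> l.
Proof.
move=> nP h A Al; apply: contrapT => nA.
have ex n : exists y, [/\ ball x n.+1%:R^-1 y, D y, P y & ~ A (G y)].
  apply: contrapT => no; apply: nA.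
  suff : nbhs x [set y | D y -> A (G y)] by [].
  have bx : nbhs x (ball x n.+1%:R^-1) by apply: nbhsx_ballx; rewrite invr_gt0.
  have nDP : nbhs x [set y | D y -> P y] by exact: nP.
  apply: filterS (filterI nDP bx) => y [DP xy] Dy; apply: contrapT => nAy.
  by apply: no; exists y; split=> //; exact: DP.
have [y_ hy] := choice ex.
have yx : y_ n @[n --> \oo] --> x.
  apply/cvg_ballP => e e0; near=> n.
  have [+ _ _ _] := hy n; apply: le_ball; apply: ltW.
  by near: n; exact: near_infty_natSinv_lt (PosNum e0).
have : \forall n \near \oo, A (G (y_ n)).
  by apply: (h y_ _ _ yx A Al) => n; have [] := hy n.
by move=> /filter_ex[n]; have [_ _ _] := hy n.
Unshelve. all: by end_near. Qed.

(** The formula for [pressure_jump] on [Omega], extended to all pairs so that its limit can be taken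
    along the full neighbourhood filter. *)
Definition jump (p : state R * state R) : R :=
  a ^+ 2 * `|expR (checkc p.2 / a) - expR (hatc p.1 / a)|.

Lemma jump_cvg (ul ur : state R) : Omega ul -> Omega ur ->
  jump p @[p --> nbhs (ul, ur)] --> jump (ul, ur).
Proof.
move=> l0 r0.
have c1 : cvg_state (nbhs (ul, ur)) fst ul by apply: cvg_cvg_state => //; exact: cvg_fst.
have c2 : cvg_state (nbhs (ul, ur)) snd ur by apply: cvg_cvg_state => //; exact: cvg_snd.
have ce (f : state R * state R -> R) (y : R) : f p @[p --> nbhs (ul, ur)] --> y ->
    expR (f p / a) @[p --> nbhs (ul, ur)] --> expR (y / a).
  move=> fy; apply: continuous_cvg; first exact: continuous_expR.
  by apply: cvgM; [exact: fy|exact: cvg_cst].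
apply: cvgM; first exact: cvg_cst.
apply: cvg_norm; apply: cvgB; apply: ce; first exact: cvg_checkc.
exact: cvg_hatc.
Qed.

Lemma integral_enorm0 (f : R -> state R) (x1 x2 : R) :
  (\int[@lebesgue_measure R]_(xi in `[x1, x2]) (enorm (f xi - f xi))%:E = 0)%E.
Proof.
apply: integral0_eq => xi _.
by rewrite subrr /enorm /= expr0n /= addr0 sqrtr0.
Qed.

Lemma RSv_L1_seq (ul ur : state R) (p_ : nat -> state R * state R) x1 x2 :
  Omega ul -> Omega ur -> (forall n, @Omega2 R (p_ n)) ->
  p_ n @[n --> \oo] --> (ul, ur) ->
  ((forall n, valveA a M (p_ n)) /\ valveA a M (ul, ur)) \/
  ((forall n, valveO a M (p_ n)) /\ valveO a M (ul, ur)) ->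
  (\int[@lebesgue_measure R]_(xi in `[x1, x2])
     (enorm (RSv a M (p_ n).1 (p_ n).2 xi - RSv a M ul ur xi))%:E)%E
    @[n --> \oo] --> 0%E.
Proof.
move=> l0 r0 p0 pp AO.
have l0_ n : Omega (p_ n).1 by have [] := p0 n.
have r0_ n : Omega (p_ n).2 by have [] := p0 n.
have cl : cvg_state \oo (fun n => (p_ n).1) ul.
  by apply: cvg_cvg_state => //; apply: (cvg_comp _ _ pp); exact: cvg_fst.
have cr : cvg_state \oo (fun n => (p_ n).2) ur.
  by apply: cvg_cvg_state => //; apply: (cvg_comp _ _ pp); exact: cvg_snd.
have cst u : cvg_state \oo (fun=> u) u by split; exact: cvg_cst.
rewrite -(integral_enorm0 (RSv a M ul ur) x1 x2).
case: AO => [[A_ A]|[V_ V]]; apply: dominated_cvg_L1.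
- by apply: dominated_cvg_closed => // n; have := A_ n; case: (p_ n).
- exact: dominated_cvg_closed.
- have -> : (fun n => RSv a M (p_ n).1 (p_ n).2) = fun n => RSp a (p_ n).1 (p_ n).2.
    by apply/funext => n; rewrite RSv_O//; have [_] := V_ n; case: (p_ n).
  by rewrite RSv_O; [exact: dominated_cvg_RSp|case: V].
- by rewrite RSv_O; [exact: dominated_cvg_RSp|case: V].
Qed.

Lemma jump_L1loc (ul ur : state R) : Omega ul -> Omega ur ->
  pressure_jump a ul ur != M -> L1loc_continuous a M ul ur.
Proof.
move=> l0 r0; rewrite pressure_jumpE// -[X in X != _]/(jump (ul, ur)).
rewrite neq_lt => /orP[J|J] x1 x2.
- apply: (@cvg_within_seq _ _ _ [set p | jump p < M]).
    by apply: cvg_within; exact: (cvgr_lt _ (jump_cvg l0 r0)).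
  move=> p_ p0 pM pp; apply: RSv_L1_seq => //; left; split.
    move=> n; have := pM n; have := p0 n; case: (p_ n) => u w [u0 w0] /ltW.
    by rewrite leNgt => /negbTE h; apply/valveAP.
  by apply/valveAP => //; apply/negbTE; rewrite -leNgt ltW.
- apply: (@cvg_within_seq _ _ _ [set p | M < jump p]).
    by apply: cvg_within; exact: (cvgr_gt _ (jump_cvg l0 r0)).
  move=> p_ p0 pM pp; apply: RSv_L1_seq => //; right; split.
    move=> n; have := pM n; have := p0 n; case: (p_ n) => u w [u0 w0] h.
    exact/valveOP.
  exact/valveOP.
Qed.

(* Increasing the larger of the two densities at rest opens the valve. *)
Lemma open_seq (ul ur : state R) : Omega ul -> Omega ur -> jump (ul, ur) = M ->
  exists p_ : nat -> state R * state R,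
    (forall n, valveO a M (p_ n)) /\ p_ n @[n --> \oo] --> (ul, ur).
Proof.
move=> l0 r0 J; pose d n : R := n.+1%:R^-1.
have d0 n : 0 < d n by rewrite invr_gt0.
have cd (c : R) : c + d n @[n --> \oo] --> c.
  rewrite -[X in _ --> X]addr0; apply: cvgD; first exact: cvg_cst.
  exact: cvg_harmonic.
have cu (u : state R) : Omega u ->
    mkst (lrho u + d n) (velocity u) @[n --> \oo] --> u.
  move=> u0; rewrite -[X in _ --> X]mkst_lrho//.
  by apply: cvg_mkst; [exact: cd|exact: cvg_cst].
have E0 (x y : R) : x < y -> expR (x / a) < expR (y / a).
  by move=> xy; rewrite ltr_expR ltr_pM2r ?invr_gt0.
have gt (x y e : R) : 0 < e -> y < x ->
    a ^+ 2 * `|expR (x / a) - expR (y / a)| = M -> far (x + e) y.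
  move=> e0 xy MJ; rewrite /far -[X in X < _]MJ ltr_pM2l ?exprn_gt0//.
  have := E0 _ _ xy; have : x < x + e by rewrite ltrDl.
  by move/E0 => h1 h2; rewrite !gtr0_norm ?subr_gt0//; lra.
case: (ltgtP (checkc ur) (hatc ul)) => h.
- exists (fun n => (mkst (lrho ul + d n) (velocity ul), ur)); split.
    move=> n; apply/valveOP => //; first exact: Omega_mkst.
    have -> : hatc (mkst (lrho ul + d n) (velocity ul)) = hatc ul + d n.
      by rewrite /hatc lrho_mkst velocity_mkst addrAC.
    by rewrite far_sym; apply: gt => //; rewrite distrC.
  exact: (cvg_pair (cu ul l0) (cvg_cst ur)).
- exists (fun n => (ul, mkst (lrho ur + d n) (velocity ur))); split.
    move=> n; apply/valveOP => //; first exact: Omega_mkst.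
    have -> : checkc (mkst (lrho ur + d n) (velocity ur)) = checkc ur + d n.
      by rewrite /checkc lrho_mkst velocity_mkst addrAC.
    exact: gt.
  exact: (cvg_pair (cvg_cst ul) (cu ur r0)).
- by move: J M_gt0; rewrite /jump /= h subrr normr0 mulr0 => <-; rewrite ltxx.
Qed.

Lemma L1loc_jump (ul ur : state R) : Omega ul -> Omega ur ->
  L1loc_continuous a M ul ur -> pressure_jump a ul ur != M.
Proof.
move=> l0 r0 L1; rewrite pressure_jumpE//; apply/eqP => J.
have [p_ [V_ pp]] := open_seq l0 r0 J.
have A : valveA a M (ul, ur) by apply/valveAP => //; rewrite /far J ltxx.
have l0_ n : Omega (p_ n).1 by have [[]] := V_ n.
have r0_ n : Omega (p_ n).2 by have [[]] := V_ n.
have cl : cvg_state \oo (fun n => (p_ n).1) ul.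
  by apply: cvg_cvg_state => //; apply: (cvg_comp _ _ pp); exact: cvg_fst.
have cr : cvg_state \oo (fun n => (p_ n).2) ur.
  by apply: cvg_cvg_state => //; apply: (cvg_comp _ _ pp); exact: cvg_snd.
have cst u : cvg_state \oo (fun=> u) u by split; exact: cvg_cst.
have w0 := RSp_Omega 0 l0 r0.
(* As the jump [M] is positive, [hatc] and [checkc] differ, so the middle state is not at rest and
   neither is [RSp] on the ray 0. *)
have q0 : (RSp a ul ur 0).2 != 0.
  apply/eqP => /eqP; rewrite -velocity_eq0// => /eqP v0.
  have := proj1 (utilde_at_rest l0 r0) (RSp0_at_rest l0 r0 v0).
  by move=> e; move: J M_gt0; rewrite e subrr normr0 mulr0 => <-; rewrite ltxx.
(* Half the momentum at 0 remains a strict lower bound just to the right of 0, where [RSv] is at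
   rest. *)
pose c := `|(RSp a ul ur 0).2| / 2.
have c0 : 0 < c by rewrite divr_gt0// normr_gt0.
have near_c : \forall xi \near 0^'+, c < `|(RSp a ul ur xi).2|.
  have cv : `|(RSp a ul ur xi).2| @[xi --> 0^'+] --> `|(RSp a ul ur 0).2|.
    apply: cvg_norm; apply: (cvg_comp _ _ (RSp_right_cvg (x := 0) l0 r0)).
    exact: cvg_snd.
  by apply: (cvgr_gt _ cv); rewrite /c ltr_pdivrMr// ltr_pMr ?normr_gt0// ltr1n.
have near_v : \forall xi \near 0^'+, RSv a M ul ur xi = mkst (checkc ur) 0.
  have k0 : Omega (mkst (checkc ur) 0) by exact: Omega_mkst.
  have [y + hy] := wave2_begin k0 r0 (link2_check ur).
  rewrite velocity_mkst => y0; near=> xi; rewrite (RSv_A _ A) ifF; last first.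
    by apply/negbTE; rewrite -leNgt; near: xi; exact: nbhs_right_ge.
  by apply: hy; near: xi; exact: nbhs_right_lt.
have [e e0 he] : exists2 e, 0 < e & forall xi, 0 < xi -> xi < e ->
    c < `|(RSp a ul ur xi).2| /\ RSv a M ul ur xi = mkst (checkc ur) 0.
  have [e /= e0 he] : \forall xi \near 0^'+, c < `|(RSp a ul ur xi).2| /\
      RSv a M ul ur xi = mkst (checkc ur) 0.
    by apply: filterS2 near_c near_v.
  exists e => // xi xi0 xie; apply: he => //=.
  by rewrite sub0r normrN gtr0_norm.
have cvg0 : (\int[@lebesgue_measure R]_(xi in `[(e / 4)%R, (e / 2)%R])
    (enorm (RSp a (p_ n).1 (p_ n).2 xi - RSv a M ul ur xi))%:E)%E
    @[n --> \oo] --> 0%E.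
  have pw : p_ n @[n --> \oo] --> within (@Omega2 R) (nbhs (ul, ur)).
    move=> B WB; suff : \forall n \near \oo, B (p_ n) by [].
    have : \forall n \near \oo, Omega2 (p_ n) -> B (p_ n) by exact: (pp _ WB).
    by apply: filterS => n; apply; exact: (conj (l0_ n) (r0_ n)).
  have := cvg_comp _ _ pw (L1 (e / 4) (e / 2)); apply: cvg_trans.
  apply: near_eq_cvg; near=> n; rewrite /= RSv_O//.
  by have [_] := V_ n; case: (p_ n).
have mg : dominated_cvg (fun=> RSv a M ul ur) (RSv a M ul ur).
  exact: dominated_cvg_closed.
have cvgI := dominated_cvg_L1 (x1 := e / 4) (x2 := e / 2)
  (dominated_cvg_RSp l0_ r0_ l0 r0 cl cr) mg.
(* The same integrals tend to 0 by assumption and to the distance between [RSp] and [RSv] by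
   dominated convergence. On the window from e / 4 to e / 2, inside the range of the lower bound,
   that distance is at least c e / 4. *)
have : (\int[@lebesgue_measure R]_(xi in `[(e / 4)%R, (e / 2)%R])
    (enorm (RSp a ul ur xi - RSv a M ul ur xi))%:E = 0)%E.
  by rewrite -(cvg_lim _ cvgI)//; apply: cvg_lim.
apply/eqP; rewrite gt_eqF//.
have mD : measurable (`[(e / 4), (e / 2)]%classic : set R) by exact: measurable_itv.
apply: (@lt_le_trans _ _
  (\int[@lebesgue_measure R]_(xi in `[(e / 4)%R, (e / 2)%R]) c%:E)%E).
  rewrite integral_cst//= lebesgue_measure_itv/= lte_fin.
  rewrite ifT; last by lra.
  by rewrite -EFinD -EFinM lte_fin mulr_gt0//; lra.
have [_ mf _ _] := dominated_cvg_RSp l0_ r0_ l0 r0 cl cr; have [_ mv _ _] := mg.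
apply: ge0_le_integral => //.
- by move=> xi _; rewrite lee_fin ltW.
- by apply/measurable_EFinP; apply: measurable_funTS; exact: measurable_enormB.
- move=> xi /=; rewrite in_itv/= => /andP[x1 x2].
  have xi0 : 0 < xi by apply: lt_le_trans x1; rewrite divr_gt0.
  have xie : xi < e.
    by apply: le_lt_trans x2 _; rewrite ltr_pdivrMr// ltr_pMr// ltr1n.
  have [h1 h2] := he xi xi0 xie.
  rewrite lee_fin h2; apply: (le_trans (ltW h1)).
  by apply: le_trans (enorm_ge2 _); rewrite /= mul0r subr0.
Unshelve. all: by end_near. Qed.

Lemma L1loc_continuity_domainE : L1loc_continuity_domain a M = Ldom a M.
Proof.
apply/seteqP; split=> -[ul ur] [[/= l0 r0] h]; split=> //.
  exact: L1loc_jump.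
exact: jump_L1loc.
Qed.

End Valve.
End Lax.

Theorem theorem4p1 (R : realType) (a M : R) (a_gt0 : 0 < a) (M_gt0 : 0 < M) :
  [/\ coherence_domain a M = CH a M,
      consistence_domain a M = CN1 a M `|` CN2 a M /\
      CN1 a M `|` CN2 a M = CNO a M `|` CNA a M,
      L1loc_continuity_domain a M = Ldom a M
    & forall u0 : state R, Omega u0 -> u0.2 = 0 ->
        invariant_domain a M (Idom a u0)].
Proof.
split.
- exact: coherence_domainE.
- by split; [exact: consistence_domainE|exact: CN_domainE].
- exact: L1loc_continuity_domainE.
- by move=> u0; exact: invariant_Idom.
Qed.
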